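(* Let $H$ be a Hopf algebra over a field $\Bbbk$, let $(C,\lambda')$, $\lambda'(c)=c^{-\overline{1}}\otimes c^{\overline{0}}$, be a left partial $H$-comodule coalgebra, and suppose that $(D,\theta,\pi)$ is a globalization for $C$ as a left partial $H$-comodule coalgebra, with coaction $\lambda(d)=d^{-1}\otimes d^{0}$ on $D$. If $H^0$ separates points, then $(D,\theta,\pi)$ is also a globalization for $C$ as a right partial $H^0$-module coalgebra, where $H^0$ acts on $D$ by $d\blacktriangleleft f=f(d^{-1})\,d^{0}$ and acts partially on $C$ by $c\leftharpoonup f=f(c^{-\overline{1}})\,c^{\overline{0}}$ ($f\in H^0$).
   Context: All objects are over a field $\Bbbk$; coalgebras are counital, $\Delta(c)=c_1\otimes c_2$. $H^0$ is the finite dual Hopf algebra of $H$; it separates points if $h\in H$ and $f(h)=0$ for all $f\in H^0$ imply $h=0$. $\tau$ denotes flips, $m_H$ the multiplication of $H$. Left $H$-comodule coalgebra $(D,\lambda)$: $(\varepsilon_H\otimes I)\lambda(d)=d$; $(I\otimes\Delta_D)\lambda(d)=(m_H\otimes I\otimes I)(I\otimes\tau_{D,H}\otimes I)(\lambda\otimes\lambda)\Delta_D(d)$; $(I\otimes\lambda)\lambda(d)=(\Delta_H\otimes I)\lambda(d)$. Left partial $H$-comodule coalgebra $(C,\lambda')$: $(\varepsilon_H\otimes I)\lambda'(c)=c$; $(I\otimes\Delta_C)\lambda'(c)=(m_H\otimes I\otimes I)(I\otimes\tau_{C,H}\otimes I)(\lambda'\otimes\lambda')\Delta_C(c)$; $(I\otimes\lambda')\lambda'(c)=(m_H\otimes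 I\otimes I)\{\nabla\otimes[(\Delta_H\otimes I)\lambda']\}\Delta_C(c)$, where $\nabla(c)=(I\otimes\varepsilon_C)\lambda'(c)$. For a Hopf algebra $K$: right $K$-module coalgebra $(D,\blacktriangleleft)$: $d\blacktriangleleft 1_K=d$, $\Delta(d\blacktriangleleft h)=d_1\blacktriangleleft h_1\otimes d_2\blacktriangleleft h_2$, $(d\blacktriangleleft h)\blacktriangleleft g=d\blacktriangleleft hg$. Right partial $K$-module coalgebra $(C,\leftharpoonup)$: $c\leftharpoonup 1_K=c$, $\Delta(c\leftharpoonup h)=c_1\leftharpoonup h_1\otimes c_2\leftharpoonup h_2$, $(c\leftharpoonup h)\leftharpoonup g=\varepsilon(c_1\leftharpoonup h_1)(c_2\leftharpoonup h_2g)$. With the formulas in the claim, $D$ is a right $H^0$-module coalgebra and $C$ a right partial $H^0$-module coalgebra. In both notions of globalization below, $\theta\colon C\to D$ is a coalgebra monomorphism (injective coalgebra map) and $\pi$ is a comultiplicative projection from $D$ onto $\theta(C)$: $\pi$ linear, $\pi\circ\pi=\pi$, image $\theta(C)$, $\Delta\circ\pi=(\pi\otimes\pi)\circ\Delta$. Globalization of a left partial $H$-comodule coalgebra $C$: a triple $(D,\theta,\pi)$ with $D$ a left $H$-comodule coalgebra such that (1) $x^{-1}\otimes\pi(x^{0})^{-1}\otimes\pi(\pi(x^{0})^{0})=x^{-1}\otimes(x^{0}{}_2)^{-1}\otimes\varepsilon(\pi(x^{0}{}_1))\pi((x^{0}{}_2)^{0})$ for all $x\in\theta(C)$; (2) $\theta$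 is an equivalence of partial comodule coalgebras: $\theta(c)^{-1}\otimes\pi(\theta(c)^{0})=c^{-\overline{1}}\otimes\theta(c^{\overline{0}})$ for all $c\in C$; (3) $D$ is generated by $\theta(C)$ as $H$-comodule coalgebra: no proper subcomodule coalgebra (subcoalgebra that is also an $H$-subcomodule) of $D$ contains $\theta(C)$. Globalization of a right partial $K$-module coalgebra $C$: a triple $(D,\theta,\pi)$ with $D$ a right $K$-module coalgebra such that for all $h\in K,c\in C,d\in D$: (1) $\pi[\pi(d)\blacktriangleleft h]=\pi[\varepsilon(\pi(d_1))d_2\blacktriangleleft h]$; (2) $\theta(c\leftharpoonup h)=\pi(\theta(c)\blacktriangleleft h)$; (3) $D=\theta(C)\blacktriangleleft K$, the linear span of the $\theta(c)\blacktriangleleft h$. *)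

(* Defs.v *)
From HB Require Import structures.
From mathcomp Require Import all_boot all_algebra.
From mathcomp Require Import boolp classical_sets functions.

Set Implicit Arguments.
Unset Strict Implicit.
Unset Printing Implicit Defensive.

Import GRing.Theory.
Local Open Scope ring_scope.
Local Open Scope quotient_scope.

Reserved Notation "U ⊗ V" (at level 40, left associativity).
Reserved Notation "\tsum_ ( u ⊗ v <- t ) E"
  (at level 41, u name, v name, E at level 41,
   format "'[' \tsum_ ( u  ⊗  v  <-  t ) '/  '  E ']'").

Definition bilin (k : fieldType) (U V W : lmodType k) (B : U -> V -> W) : Prop :=
  (forall v, linear (fun u => B u v)) /\ (forall u, linear (B u)).

Section Tensor.
Variables (k : fieldType) (U V : lmodType k).
Implicit Types s t : seq (U * V).

(* U ⊗ V is the commutative monoid generated by the pairs (u, v), modulo the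
   usual bilinearity relations; a list stands for the sum of its entries.  The
   relation (0, v) = 0 makes the monoid a group, and the action of the scalars
   on the left components a vector space. *)
Inductive tens_eq : seq (U * V) -> seq (U * V) -> Prop :=
| tens_eq_refl s : tens_eq s s
| tens_eq_sym s t : tens_eq s t -> tens_eq t s
| tens_eq_trans s t r : tens_eq s t -> tens_eq t r -> tens_eq s r
| tens_eq_cat s s' t t' :
    tens_eq s s' -> tens_eq t t' -> tens_eq (s ++ t) (s' ++ t')
| tens_eq_catC s t : tens_eq (s ++ t) (t ++ s)
| tens_eq_0l v : tens_eq [:: (0, v)] [::]
| tens_eq_Dl u u' v : tens_eq [:: (u + u', v)] [:: (u, v); (u', v)]
| tens_eq_Dr u v v' : tens_eq [:: (u, v + v')] [:: (u, v); (u, v')]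
| tens_eq_Z a u v : tens_eq [:: (a *: u, v)] [:: (u, a *: v)].

Definition tens_eqb : rel (seq (U * V)) := fun s t => `[< tens_eq s t >].

Lemma tens_eqb_equiv : equiv_class_of tens_eqb.
Proof.
split.
- by move=> s; apply/asboolP; exact: tens_eq_refl.
- by move=> s t; apply/asboolP/asboolP; exact: tens_eq_sym.
- move=> t s r /asboolP st /asboolP tr; apply/asboolP; exact: tens_eq_trans tr.
Qed.

Canonical tens_equiv := EquivRelPack tens_eqb_equiv.

Definition tensor : Type := {eq_quot tens_equiv}.

HB.instance Definition _ := Choice.on tensor.
HB.instance Definition _ := EqQuotient.on tensor.

Lemma tensP s t : tens_eq s t <-> \pi_tensor s = \pi_tensor t.
Proof.
by split=> [st|/eqmodP/asboolP//]; apply/eqmodP/asboolP.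
Qed.

Lemma tens_repr (s : seq (U * V)) : tens_eq (repr (\pi_tensor s)) s.
Proof. by apply/tensP; rewrite reprK. Qed.

Definition tens0 : tensor := \pi_tensor [::].
Definition tens_add (x y : tensor) : tensor := \pi_tensor (repr x ++ repr y).
Definition tens_scale (a : k) (x : tensor) : tensor :=
  \pi_tensor [seq (a *: p.1, p.2) | p <- repr x].

Lemma tens_addE s t : tens_add (\pi s) (\pi t) = \pi_tensor (s ++ t).
Proof. by apply/tensP; apply: tens_eq_cat; exact: tens_repr. Qed.

Lemma tens_eq_map (a : k) s t : tens_eq s t ->
  tens_eq [seq (a *: p.1, p.2) | p <- s] [seq (a *: p.1, p.2) | p <- t].
Proof.
elim=> {s t} /=.
- by move=> s; exact: tens_eq_refl.
- by move=> s t _; exact: tens_eq_sym.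
- by move=> s t r _ st _ tr; exact: tens_eq_trans tr.
- by move=> s s' t t' _ st _ tr; rewrite !map_cat; exact: tens_eq_cat.
- by move=> s t; rewrite !map_cat; exact: tens_eq_catC.
- by move=> v; rewrite scaler0; exact: tens_eq_0l.
- by move=> u u' v; rewrite scalerDr; exact: tens_eq_Dl.
- by move=> u v v'; exact: tens_eq_Dr.
- by move=> b u v; rewrite scalerA mulrC -scalerA; exact: tens_eq_Z.
Qed.

Lemma tens_scaleE a s :
  tens_scale a (\pi s) = \pi_tensor [seq (a *: p.1, p.2) | p <- s].
Proof. by apply/tensP; apply: tens_eq_map; exact: tens_repr. Qed.

Definition tens_opp := tens_scale (-1).

Lemma tens_addA : associative tens_add.
Proof.
elim/quotW=> x; elim/quotW=> y; elim/quotW=> z.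
by rewrite !tens_addE catA.
Qed.

Lemma tens_addC : commutative tens_add.
Proof.
elim/quotW=> x; elim/quotW=> y; rewrite !tens_addE; apply/tensP.
exact: tens_eq_catC.
Qed.

Lemma tens_add0 : left_id tens0 tens_add.
Proof. by elim/quotW=> x; rewrite tens_addE. Qed.

Lemma tens_catAC p (s t : seq (U * V)) : tens_eq (s ++ p :: t) (p :: s ++ t).
Proof.
rewrite -cat1s catA.
exact: tens_eq_cat (tens_eq_catC s [:: p]) (tens_eq_refl t).
Qed.

Lemma tens_addN : left_inverse tens0 tens_opp tens_add.
Proof.
elim/quotW=> s; rewrite /tens_opp tens_scaleE tens_addE; apply/tensP.
elim: s => [|[u v] s IH] /=; first exact: tens_eq_refl.
rewrite -(cat1s _ (_ ++ _)).
apply: (@tens_eq_trans _ ([:: (-1 *: u, v)] ++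
  ((u, v) :: [seq (-1 *: p.1, p.2) | p <- s] ++ s))).
  by apply: tens_eq_cat (tens_eq_refl _) _; exact: tens_catAC.
rewrite -(cat1s (u, v)) catA /= -(cat1s _ (_ :: _)) -(cat1s _ (_ ++ _)) catA.
apply: (@tens_eq_trans _ ([::] ++ [::])); last exact: tens_eq_refl.
apply: tens_eq_cat IH => /=.
apply: tens_eq_trans (tens_eq_0l v).
rewrite scaleN1r -(addNr u); apply: tens_eq_sym; exact: tens_eq_Dl.
Qed.

HB.instance Definition _ := GRing.isZmodule.Build tensor
  tens_addA tens_addC tens_add0 tens_addN.

Lemma tens_scaleA a b x : tens_scale a (tens_scale b x) = tens_scale (a * b) x.
Proof.
elim/quotW: x => s; rewrite !tens_scaleE -map_comp; congr (\pi _).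
by apply: eq_map => p /=; rewrite scalerA.
Qed.

Lemma tens_scale1 : left_id 1 tens_scale.
Proof.
elim/quotW=> s; rewrite !tens_scaleE; congr (\pi _).
by rewrite -[RHS]map_id; apply: eq_map => -[u v] /=; rewrite scale1r.
Qed.

Lemma tens_scaleDr : right_distributive tens_scale +%R.
Proof.
move=> a; elim/quotW=> s; elim/quotW=> t.
by rewrite /GRing.add /= tens_addE !tens_scaleE tens_addE map_cat.
Qed.

Lemma tens_scaleDl x : {morph tens_scale^~ x : a b / a + b}.
Proof.
elim/quotW: x => s a b; rewrite !tens_scaleE.
rewrite [RHS]tens_addE; apply/tensP.
elim: s => [|[u v] s IH] /=; first exact: tens_eq_refl.
have /tens_eq_sym H := tens_catAC (b *: u, v)
  [seq (a *: p.1, p.2) | p <- s] [seq (b *: p.1, p.2) | p <- s].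
rewrite -cat1s -(cat1s _ (_ ++ _)).
apply: tens_eq_trans; last exact: (tens_eq_cat (tens_eq_refl _) H).
rewrite -(cat1s (b *: u, v)) catA; apply: tens_eq_cat IH.
by rewrite scalerDl; exact: tens_eq_Dl.
Qed.

HB.instance Definition _ := GRing.Zmodule_isLmodule.Build k tensor
  tens_scaleA tens_scale1 tens_scaleDr tens_scaleDl.

Definition tens (u : U) (v : V) : tensor := \pi_tensor [:: (u, v)].

Lemma tens_piD s t : \pi_tensor s + \pi_tensor t = \pi_tensor (s ++ t).
Proof. exact: tens_addE. Qed.

Lemma tens_piZ a s :
  a *: \pi_tensor s = \pi_tensor [seq (a *: p.1, p.2) | p <- s].
Proof. exact: tens_scaleE. Qed.

Lemma tens_bilin : bilin tens.
Proof.
split=> [v a u u'|u a v v'].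
- apply/esym; rewrite /tens tens_piZ tens_piD /=.
  by apply/tensP/tens_eq_sym; exact: tens_eq_Dl.
- apply/esym; rewrite /tens tens_piZ tens_piD /=.
  apply/tensP/tens_eq_sym; apply: tens_eq_trans (tens_eq_Dr _ _ _) _.
  apply: (@tens_eq_cat [:: _] [:: _] [:: _] [:: _] _ (tens_eq_refl _)).
  by apply: tens_eq_sym; exact: tens_eq_Z.
Qed.

Lemma tens_sum s : \pi_tensor s = \sum_(p <- s) tens p.1 p.2.
Proof.
elim: s => [|[u v] s IH]; first by rewrite big_nil.
by rewrite big_cons -IH tens_piD.
Qed.


Variable W : lmodType k.

(* tlift t B is the image of t under the linear map U ⊗ V -> W induced by B.
   This requires B to be bilinear (see tliftE and tlift_linear); for other B the
   value depends on the representative of t. *)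
Definition tlift (x : tensor) (B : U -> V -> W) : W :=
  \sum_(p <- repr x) B p.1 p.2.

Lemma linear0P (X Y : lmodType k) (f : X -> Y) : linear f -> f 0 = 0.
Proof. by move=> /(_ (-1) 0 0); rewrite scaler0 addr0 scaleN1r addNr. Qed.

Lemma linearDP (X Y : lmodType k) (f : X -> Y) : linear f -> {morph f : x y / x + y}.
Proof. by move=> lf x y; have := lf 1 x y; rewrite !scale1r. Qed.

Lemma linearZP (X Y : lmodType k) (f : X -> Y) a :
  linear f -> {morph f : x / a *: x}.
Proof. by move=> lf x; have := lf a x 0; rewrite (linear0P lf) !addr0. Qed.

Lemma tlift_pi B s : bilin B -> tlift (\pi s) B = \sum_(p <- s) B p.1 p.2.
Proof.
move=> [Bl Br]; rewrite /tlift.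
move: (repr _) (tens_repr s) => t; elim=> {s t} //.
- by move=> s t r _ -> _ ->.
- by move=> s s' t t' _ E _ E'; rewrite !big_cat /= E E'.
- by move=> s t; rewrite !big_cat /= addrC.
- by move=> v; rewrite big_seq1 big_nil /= (linear0P (Bl v)).
- by move=> u u' v; rewrite !big_cons !big_nil !addr0 /= (linearDP (Bl v)).
- by move=> u v v'; rewrite !big_cons !big_nil !addr0 /= (linearDP (Br u)).
- by move=> a u v; rewrite !big_seq1 /= (linearZP a (Br u)) (linearZP a (Bl v)).
Qed.

Lemma tliftE B u v : bilin B -> tlift (tens u v) B = B u v.
Proof. by move=> hB; rewrite tlift_pi // big_seq1. Qed.

Lemma tlift_linear B : bilin B -> linear (fun x : tensor => tlift x B).
Proof.
move=> hB a; elim/quotW=> s; elim/quotW=> t.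
rewrite tens_piZ tens_piD !tlift_pi // big_cat big_map /=; congr (_ + _).
rewrite scaler_sumr; apply: eq_bigr => p _.
by case: hB => Bl _; rewrite (linearZP a (Bl p.2)).
Qed.
End Tensor.

Notation "U ⊗ V" := (tensor U%type V%type) : type_scope.
Notation "u ⊗ v" := (tens u v) : ring_scope.
(* Sweedler notation: with t = sum_i u_i ⊗ v_i, this is sum_i E(u_i, v_i); the
   expression E is bilinear in (u, v) in all uses. *)
Notation "\tsum_ ( u ⊗ v <- t ) E" := (tlift t (fun u v => E)) : ring_scope.

(* Same as linear, but without the scaling-law structure inserted by linear_for,
   so that rewriting and the tactic below work on it syntactically. *)
Definition lin (k : fieldType) (X Y : lmodType k) (f : X -> Y) : Prop :=
  forall a x y, f (a *: x + y) = a *: f x + f y.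

Section Lin.
Variable k : fieldType.
Implicit Types X Y Z U V W : lmodType k.

Lemma lin_linear X Y (f : X -> Y) : lin f -> linear f. Proof. by []. Qed.
Lemma linear_lin X Y (f : {linear X -> Y}) : lin f.
Proof. by move=> a x y; rewrite linearP. Qed.
Lemma scalar_lin X (f : {scalar X}) : @lin k X k^o f.
Proof. by move=> a x y; rewrite linearP. Qed.
Lemma lin_id X : lin (fun x : X => x). Proof. by []. Qed.
Lemma lin_comp X Y Z (f : Y -> Z) (g : X -> Y) :
  lin f -> lin g -> lin (fun x => f (g x)).
Proof. by move=> lf lg a x y; rewrite lg lf. Qed.
Lemma lin_add X Y (f g : X -> Y) : lin f -> lin g -> lin (fun x => f x + g x).
Proof. by move=> lf lg a x y; rewrite lf lg scalerDr addrACA. Qed.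
Lemma lin_scaler X Y (f : X -> Y) b : lin f -> lin (fun x => b *: f x).
Proof. by move=> lf a x y; rewrite lf scalerDr !scalerA mulrC. Qed.
Lemma lin_scalel X Y (f : X -> k) (v : Y) :
  @lin k X k^o f -> lin (fun x => f x *: v).
Proof. by move=> lf a x y; rewrite lf scalerDl scalerA. Qed.
Lemma lin_sum (I : Type) (r : seq I) (P : pred I) X Y (f : I -> X -> Y) :
  (forall i, lin (f i)) -> lin (fun x => \sum_(i <- r | P i) f i x).
Proof.
move=> lf a x y; rewrite scaler_sumr -big_split /=.
by apply: eq_bigr => i _; rewrite lf.
Qed.
Lemma lin_mull X (A : algType k) (f : X -> A) (b : A) :
  lin f -> lin (fun x => f x * b).
Proof. by move=> lf a x y; rewrite lf mulrDl scalerAl. Qed.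
Lemma lin_mulr X (A : algType k) (f : X -> A) (b : A) :
  lin f -> lin (fun x => b * f x).
Proof. by move=> lf a x y; rewrite lf mulrDr scalerAr. Qed.
Lemma lin_mulkl X (f : X -> k) (b : k) :
  @lin k X k^o f -> @lin k X k^o (fun x => f x * b).
Proof. by move=> lf a x y; rewrite lf /GRing.scale /= mulrDl mulrA. Qed.
Lemma lin_mulkr X (f : X -> k) (b : k) :
  @lin k X k^o f -> @lin k X k^o (fun x => b * f x).
Proof. by move=> lf a x y; rewrite lf /GRing.scale /= mulrDr mulrCA. Qed.

Lemma bilinI U V W (B : U -> V -> W) :
  (forall v, lin (fun u => B u v)) -> (forall u, lin (fun v => B u v)) ->
  bilin B.
Proof. by []. Qed.

Lemma lin_tensl X U V (f : X -> U) (v : V) : lin f -> lin (fun x => f x ⊗ v).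
Proof. by move=> lf a x y; rewrite lf; case: (tens_bilin U V) => H _; apply: H. Qed.
Lemma lin_tensr X U V (f : X -> V) (u : U) : lin f -> lin (fun x => u ⊗ f x).
Proof. by move=> lf a x y; rewrite lf; case: (tens_bilin U V) => _ H; apply: H. Qed.
Lemma lin_tlift X U V W (B : U -> V -> W) (f : X -> U ⊗ V) :
  lin f -> bilin B -> lin (fun x => tlift (f x) B).
Proof. by move=> lf hB a x y; rewrite lf; exact: tlift_linear. Qed.
Lemma lin_tlift_body X U V W (B : X -> U -> V -> W) (t : U ⊗ V) :
  (forall u v, lin (fun x => B x u v)) -> lin (fun x => tlift t (B x)).
Proof. by move=> lf; apply: lin_sum => i; exact: lf. Qed.

Lemma lin_tsum U V W W' (F : W -> W') (B : U -> V -> W) t :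
  lin F -> F (tlift t B) = \tsum_(u ⊗ v <- t) F (B u v).
Proof.
move=> lF; rewrite /tlift.
elim: (repr t) => [|p s IH]; first by rewrite !big_nil (linear0P lF).
by rewrite !big_cons (linearDP lF) IH.
Qed.

Lemma eq_tlift U V W (B B' : U -> V -> W) t :
  (forall u v, B u v = B' u v) -> tlift t B = tlift t B'.
Proof. by move=> E; apply: eq_bigr => p _; rewrite E. Qed.

Lemma exchange_tlift U V U' V' W (B : U -> V -> U' -> V' -> W) s t :
  \tsum_(u ⊗ v <- s) \tsum_(u' ⊗ v' <- t) B u v u' v' =
  \tsum_(u' ⊗ v' <- t) \tsum_(u ⊗ v <- s) B u v u' v'.
Proof. exact: exchange_big. Qed.

Lemma tens_tsum U V (t : U ⊗ V) : \tsum_(u ⊗ v <- t) (u ⊗ v) = t.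
Proof. by rewrite -[RHS]reprK tens_sum. Qed.

Lemma tens_ext U V W (f g : U ⊗ V -> W) : lin f -> lin g ->
  (forall u v, f (u ⊗ v) = g (u ⊗ v)) -> f =1 g.
Proof.
move=> lf lg E t; rewrite -(tens_tsum t) !lin_tsum //.
by apply: eq_tlift => u v.
Qed.

(* If functionals F separate the points of U and functionals G those of V, then
   their tensor products separate the points of U ⊗ V. *)
Lemma tens_sep U V (I J : Type) (F : I -> U -> k) (G : J -> V -> k) :
  (forall i, @lin k U k^o (F i)) -> (forall j, @lin k V k^o (G j)) ->
  (forall u, (forall i, F i u = 0) -> u = 0) ->
  (forall v, (forall j, G j v = 0) -> v = 0) ->
  forall t : U ⊗ V,
  (forall i j, (\tsum_(u ⊗ v <- t) (F i u * G j v : k^o)) = 0) -> t = 0.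
Proof.
move=> lF lG sF sG t ht; rewrite -(reprK t) tens_sum.
have {ht}: forall i j, \sum_(p <- repr t) F i p.1 * G j p.2 = 0 by exact: ht.
have [n] := ubnP (size (repr t)); elim: n (repr t) => // n IH.
case=> [|[u v] s]; first by rewrite big_nil.
rewrite /= ltnS => ns hs; rewrite big_cons /=.
have [u0|/eqP/(contra_not (sF u))/existsNP [i /eqP Fu]] := eqVneq u 0.
  have tl := lin_tensl v (@lin_id U).
  rewrite u0 (linear0P tl) add0r; apply: IH => // i j.
  by have := hs i j; rewrite big_cons /= u0 (linear0P (lF i)) mul0r add0r.
pose a p := F i p / F i u.
have Ev : v = - \sum_(p <- s) a p.1 *: p.2.
  apply/eqP; rewrite -addr_eq0; apply/eqP; apply: sG => j.
  have := hs i j; rewrite big_cons /= => /(congr1 ( *%R (F i u)^-1)).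
  rewrite mulr0 mulrDr mulKf // => E.
  rewrite (linearDP (lG j)) -[RHS]E; congr (_ + _).
  have -> : G j (\sum_(p <- s) a p.1 *: p.2) = \sum_(p <- s) a p.1 * G j p.2.
    elim: (s) => [|p l IHl]; first by rewrite !big_nil (linear0P (lG j)).
    by rewrite !big_cons (linearDP (lG j)) IHl (linearZP _ (lG j)).
  rewrite mulr_sumr; apply: eq_bigr => p _; rewrite /a.
  by rewrite mulrA; congr (_ * _); rewrite mulrC.
have Euv : u ⊗ v = \sum_(p <- s) (- a p.1 *: u) ⊗ p.2.
  rewrite Ev -sumrN.
  have tr := lin_tensr u (@lin_id V).
  elim: (s) => [|p l IHl]; first by rewrite !big_nil (linear0P tr).
  rewrite !big_cons (linearDP tr) IHl; congr (_ + _).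
  rewrite -scaleNr (linearZP _ tr).
  by rewrite (linearZP _ (lin_tensl p.2 (@lin_id U))).
pose s' := [seq (p.1 - a p.1 *: u, p.2) | p <- s].
have -> : u ⊗ v + \sum_(p <- s) p.1 ⊗ p.2 = \sum_(p <- s') p.1 ⊗ p.2.
  rewrite Euv -big_split big_map; apply: eq_bigr => p _ /=.
  by rewrite -(linearDP (lin_tensl p.2 (@lin_id U))) addrC scaleNr.
apply: IH; first by rewrite size_map.
move=> i' j; rewrite big_map /=.
have := hs i' j; rewrite big_cons /= => E; rewrite -[RHS]E.
have -> : G j v = - \sum_(p <- s) a p.1 * G j p.2.
  rewrite Ev -sumrN.
  elim: (s) => [|p l IHl]; first by rewrite !big_nil (linear0P (lG j)) oppr0.
  rewrite !big_cons (linearDP (lG j)) IHl opprD; congr (_ + _).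
  by rewrite -scaleNr (linearZP _ (lG j)); exact: mulNr.
rewrite mulrN addrC mulr_sumr -sumrB; apply: eq_bigr => p _.
rewrite (linearDP (lF i')) -scaleNr (linearZP _ (lF i')) mulrDl; congr (_ + _).
by rewrite [- _ *: _]mulNr mulNr mulrA; congr (- (_ * _)); exact: mulrC.
Qed.
End Lin.

Ltac lin_step := cbv beta; first
  [ exact: lin_id
  | match goal with
    | |- bilin _ => apply: bilinI; intro
    | |- lin (fun x => tlift (@?L x) ?B) => apply: (@lin_tlift _ _ _ _ _ B L)
    | |- lin (fun x => tlift ?t (@?B x)) =>
        apply: (@lin_tlift_body _ _ _ _ _ B t); intros ? ?
    | |- lin (fun x => tens (@?f x) ?v) => apply: (@lin_tensl _ _ _ _ f v)
    | |- lin (fun x => tens ?u (@?f x)) => apply: (@lin_tensr _ _ _ _ f u)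
    end
  | apply: lin_scaler | apply: lin_scalel
  | apply: lin_mull | apply: lin_mulr | apply: lin_mulkl | apply: lin_mulkr
  | apply: lin_add
  | apply: (lin_comp (linear_lin _)) | apply: (lin_comp (scalar_lin _))
  | exact: linear_lin | exact: scalar_lin
  | done ].
Ltac lin := intros; repeat lin_step.

HB.mixin Record Lmodule_isCoalgebra (k : fieldType) C of GRing.Lmodule k C := {
  comul : {linear C -> (C ⊗ C)%type};
  counit : {scalar C};
  comulA : forall c : C,
    \tsum_(c1 ⊗ c2 <- comul c) \tsum_(c11 ⊗ c12 <- comul c1) c11 ⊗ (c12 ⊗ c2) =
    \tsum_(c1 ⊗ c2 <- comul c) c1 ⊗ comul c2;
  counitl : forall c : C, \tsum_(c1 ⊗ c2 <- comul c) counit c1 *: c2 = c;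
  counitr : forall c : C, \tsum_(c1 ⊗ c2 <- comul c) counit c2 *: c1 = c
}.

#[short(type="coalgType")]
HB.structure Definition Coalgebra (k : fieldType) :=
  {C of GRing.Lmodule k C & Lmodule_isCoalgebra k C}.

HB.mixin Record Algebra_Coalgebra_isBialgebra (k : fieldType) H
    of GRing.Algebra k H & Coalgebra k H := {
  comul1 : comul (1 : H) = 1 ⊗ 1;
  comulM : forall x y : H, comul (x * y) =
    \tsum_(x1 ⊗ x2 <- comul x) \tsum_(y1 ⊗ y2 <- comul y) (x1 * y1) ⊗ (x2 * y2);
  counit1 : counit (1 : H) = 1;
  counitM : forall x y : H, counit (x * y) = counit x * counit y
}.

#[short(type="bialgType")]
HB.structure Definition Bialgebra (k : fieldType) :=
  {H of GRing.Algebra k H & Coalgebra k H & Algebra_Coalgebra_isBialgebra k H}.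

HB.mixin Record Bialgebra_isHopf (k : fieldType) H of Bialgebra k H := {
  antipode : {linear H -> H};
  antipodel : forall x : H,
    \tsum_(x1 ⊗ x2 <- comul x) antipode x1 * x2 = (counit x)%:A;
  antipoder : forall x : H,
    \tsum_(x1 ⊗ x2 <- comul x) x1 * antipode x2 = (counit x)%:A
}.

#[short(type="hopfType")]
HB.structure Definition Hopf (k : fieldType) :=
  {H of Bialgebra k H & Bialgebra_isHopf k H}.


Section CoalgTheory.
Variables (k : fieldType).
Lemma coassoc3 (C : coalgType k) (W : lmodType k) (T : C -> C -> C -> W) (c : C) :
  (forall a b, lin (T a b)) -> (forall a b, lin (fun x => T a x b)) ->
  (forall a b, lin (fun x => T x a b)) ->
  \tsum_(c1 ⊗ c2 <- comul c) \tsum_(c11 ⊗ c12 <- comul c1) T c11 c12 c2 =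
  \tsum_(c1 ⊗ c2 <- comul c) \tsum_(c21 ⊗ c22 <- comul c2) T c1 c21 c22.
Proof.
move=> T3 T2 T1.
have hB a : bilin (T a) by lin.
pose F t := \tsum_(a ⊗ u <- t) tlift u (T a).
have hF : bilin (fun a u => tlift u (T a)) by lin.
have lF : lin F by rewrite /F; lin.
have := congr1 F (comulA c); rewrite !(lin_tsum _ _ lF) => E.
transitivity (\tsum_(u ⊗ v <- comul c) F (u ⊗ comul v)); last first.
  by apply: eq_tlift => u v; rewrite /F tliftE.
rewrite -{}E; apply: eq_tlift => u v; rewrite (lin_tsum _ _ lF).
by apply: eq_tlift => x y; rewrite /F tliftE // tliftE.
Qed.

Lemma bilin_mul (A : algType k) : bilin (fun x y : A => x * y).
Proof. lin. Qed.

Lemma tsum_scale (C D : lmodType k) (W : lmodType k) (B : C -> D -> W)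
   (f : C -> D -> k) (w : W) (t : C ⊗ D) :
  \tsum_(c ⊗ d <- t) (f c d *: w) = (\tsum_(c ⊗ d <- t) (f c d : k^o)) *: w.
Proof. by rewrite /tlift scaler_suml. Qed.


Lemma tsum_mulr (U V : lmodType k) (A : algType k) (B : U -> V -> A) t a :
  a * tlift t B = \tsum_(u ⊗ v <- t) (a * B u v).
Proof. exact: mulr_sumr. Qed.
Lemma tsum_mull (U V : lmodType k) (A : algType k) (B : U -> V -> A) t a :
  tlift t B * a = \tsum_(u ⊗ v <- t) (B u v * a).
Proof. exact: mulr_suml. Qed.
Lemma linear_tsum (U V W W' : lmodType k) (F : {linear W -> W'}) (B : U -> V -> W) t :
  F (tlift t B) = \tsum_(u ⊗ v <- t) F (B u v).
Proof. exact: raddf_sum. Qed.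
Lemma scale_tsum (U V W : lmodType k) (B : U -> V -> W) t a :
  a *: tlift t B = \tsum_(u ⊗ v <- t) (a *: B u v).
Proof. exact: scaler_sumr. Qed.

Lemma antipodeM (H : hopfType k) (x y : H) :
  antipode (x * y) = antipode y * antipode x.
Proof.
have lS := linear_lin (@antipode k H).
pose E := \tsum_(x1 ⊗ x2 <- comul x) \tsum_(x21 ⊗ x22 <- comul x2)
   \tsum_(y1 ⊗ y2 <- comul y) \tsum_(y21 ⊗ y22 <- comul y2)
   (antipode (x1 * y1) * ((x21 * y21) * (antipode y22 * antipode x22))).
have E1 : E = antipode (x * y).
  transitivity (\tsum_(x1 ⊗ x2 <- comul x) \tsum_(y1 ⊗ y2 <- comul y)
     (antipode (x1 * y1) * ((counit x2 * counit y2)%:A))).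
    apply: eq_tlift => x1 x2; rewrite exchange_tlift.
    transitivity (\tsum_(y1 ⊗ y2 <- comul y)
       antipode (x1 * y1) * \tsum_(x21 ⊗ x22 <- comul x2)
        (x21 * (\tsum_(y21 ⊗ y22 <- comul y2) y21 * antipode y22) * antipode x22)).
      apply: eq_tlift => y1 y2.
      rewrite tsum_mulr; apply: eq_tlift => x21 x22.
      rewrite tsum_mulr tsum_mull tsum_mulr.
      by apply: eq_tlift => y21 y22; rewrite !mulrA.
    apply: eq_tlift => y1 y2; congr (_ * _); rewrite antipoder.
    transitivity (\tsum_(x21 ⊗ x22 <- comul x2) (counit y2 *: (x21 * antipode x22))).
      by apply: eq_tlift => x21 x22; rewrite -scalerAr mulr1 -scalerAl.
    rewrite -scale_tsum antipoder.
    by rewrite scalerA mulrC.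
  transitivity (\tsum_(x1 ⊗ x2 <- comul x) \tsum_(y1 ⊗ y2 <- comul y)
     antipode ((counit x2 *: x1) * (counit y2 *: y1))).
    apply: eq_tlift => x1 x2; apply: eq_tlift => y1 y2.
    by rewrite -scalerAr mulr1 -scalerAl -scalerAr scalerA [RHS]linearZ.
  transitivity (\tsum_(x1 ⊗ x2 <- comul x) antipode ((counit x2 *: x1) * y)).
    apply: eq_tlift => x1 x2; rewrite -[in RHS](counitr y).
    by rewrite tsum_mulr linear_tsum.
  by rewrite -[in RHS](counitr x) tsum_mull linear_tsum.
rewrite -E1 /E.
transitivity (\tsum_(x1 ⊗ x2 <- comul x) \tsum_(x11 ⊗ x12 <- comul x1)
   \tsum_(y1 ⊗ y2 <- comul y) \tsum_(y11 ⊗ y12 <- comul y1)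
   (antipode (x11 * y11) * ((x12 * y12) * (antipode y2 * antipode x2)))).
  rewrite coassoc3; [|by lin|by lin|by lin].
  apply: eq_tlift => x1 x2; apply: eq_tlift => x21 x22.
  by rewrite coassoc3 //; lin.
transitivity (\tsum_(x1 ⊗ x2 <- comul x) \tsum_(y1 ⊗ y2 <- comul y)
  ((counit x1 * counit y1) *: (antipode y2 * antipode x2))).
  apply: eq_tlift => x1 x2; rewrite exchange_tlift; apply: eq_tlift => y1 y2.
  transitivity ((\tsum_(z1 ⊗ z2 <- comul (x1 * y1)) antipode z1 * z2) *
     (antipode y2 * antipode x2)).
    rewrite comulM.
    pose F t : H := \tsum_(z1 ⊗ z2 <- t) antipode z1 * z2.
    have hF : bilin (fun z1 z2 : H => antipode z1 * z2) by lin.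
    have lF : lin F by rewrite /F; lin.
    rewrite -/(F _) (lin_tsum _ _ lF) tsum_mull.
    apply: eq_tlift => a b; rewrite (lin_tsum _ _ lF) tsum_mull.
    by apply: eq_tlift => c d; rewrite /F tliftE // mulrA.
  by rewrite antipodel counitM -scalerAl mul1r.
transitivity (\tsum_(x1 ⊗ x2 <- comul x)
   (antipode (\tsum_(y1 ⊗ y2 <- comul y) counit y1 *: y2) * antipode (counit x1 *: x2))).
  apply: eq_tlift => x1 x2; rewrite linear_tsum tsum_mull.
  apply: eq_tlift => y1 y2.
  by rewrite !linearZ -scalerAl -scalerAr scalerA mulrC.
by rewrite counitl -[in RHS](counitl x) linear_tsum tsum_mulr.
Qed.
End CoalgTheory.

Local Open Scope classical_set_scope.

Section Subspace.
Variable k : fieldType.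

Definition is_subspace (V : lmodType k) (P : set V) : Prop :=
  P 0 /\ forall a x y, P x -> P y -> P (a *: x + y).

Definition two_sided_ideal (A : algType k) (I : set A) : Prop :=
  is_subspace I /\ forall a x, I x -> I (a * x) /\ I (x * a).

(* V / P is spanned by finitely many classes. *)
Definition finite_codim (V : lmodType k) (P : set V) : Prop :=
  exists n (e : 'I_n -> V), forall v, exists a : 'I_n -> k,
    P (v - \sum_i a i *: e i).

Lemma subspaceB (V : lmodType k) (P : set V) x y : is_subspace P ->
  P x -> P y -> P (x - y).
Proof. by move=> [_ h] Px Py; rewrite addrC -scaleN1r; exact: h. Qed.

Lemma subspaceZ (V : lmodType k) (P : set V) a x : is_subspace P ->
  P x -> P (a *: x).
Proof. by move=> [h0 h] Px; rewrite -[_ *: _]addr0; exact: h. Qed.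

Lemma subspaceD (V : lmodType k) (P : set V) x y : is_subspace P ->
  P x -> P y -> P (x + y).
Proof. by move=> [h0 h] Px; rewrite -[x]scale1r; exact: h. Qed.

Lemma subspace_sum (V : lmodType k) (P : set V) (J : Type) (r : seq J)
  (F : J -> V) : is_subspace P -> (forall j, P (F j)) -> P (\sum_(j <- r) F j).
Proof.
move=> sP hF; elim: r => [|j r IH]; first by rewrite big_nil; case: sP.
by rewrite big_cons; apply: subspaceD.
Qed.

Lemma finite_codim_cap (V : lmodType k) (P : set V) (f : V -> k) :
  is_subspace P -> @lin k V k^o f -> finite_codim P ->
  finite_codim (P `&` [set v | f v = 0]).
Proof.
move=> sP lf [n [e he]].
have [p [Pp fp]] : exists p, P p /\ forall q, P q -> P (q - f q *: p) /\ f (q - f q *: p) = 0.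
  have [h|/existsNP[p /not_implyP[Pp /eqP fp]]] := pselect (forall q, P q -> f q = 0).
    exists 0; split; first by case: sP.
    by move=> q Pq; rewrite scaler0 subr0 h.
  exists ((f p)^-1 *: p); split; first exact: subspaceZ.
  move=> q Pq; split; first by apply: subspaceB => //; do 2! apply: subspaceZ => //.
  rewrite scalerA -scaleNr (linearDP lf) (linearZP _ lf) /GRing.scale /=.
  by rewrite mulNr -mulrA mulVf // mulr1 subrr.
exists n.+1, (fun i => if unlift ord0 i is Some j then e j else p) => v.
have [a Pa] := he v.
set q := v - _ in Pa.
exists (fun i => if unlift ord0 i is Some j then a j else f q).
rewrite big_ord_recl unlift_none.
under eq_bigr do rewrite liftK.
rewrite opprD addrCA addrC -/q.
by case: (fp _ Pa).
Qed.

Lemma finite_codim_ker (V : lmodType k) (J : finType) (f : J -> V -> k) :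
  (forall j, @lin k V k^o (f j)) -> finite_codim [set v | forall j, f j v = 0].
Proof.
move=> lf; have sS (s : seq J) : is_subspace [set v | forall j, j \in s -> f j v = 0].
  split=> [j _|a x y fx fy j js]; first exact: (linear0P (lf j)).
  by rewrite lf fx // fy // scaler0 addr0.
have : finite_codim [set v | forall j, j \in enum J -> f j v = 0].
  elim: (enum J) => [|j s IH].
    by exists 0, (fun _ => 0) => v; exists (fun _ => 0) => j.
  have [n [e he]] := finite_codim_cap (sS s) (lf j) IH.
  exists n, e => v; have [a [h1 h2]] := he v; exists a => i.
  by rewrite inE => /orP[/eqP->//|/h1].
move=> [n [e he]]; exists n, e => v; have [a h] := he v; exists a => i.
by apply: h; rewrite mem_enum.
Qed.

Lemma finite_codim_basis (V : lmodType k) (P : set V) : is_subspace P ->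
  finite_codim P -> exists n (e : 'I_n -> V) (f : 'I_n -> V -> k),
  [/\ forall i, @lin k V k^o (f i),
      forall v, P (v - \sum_i f i v *: e i) &
      forall v, P v -> forall i, f i v = 0].
Proof.
move=> sP hP.
pose span n := exists e : 'I_n -> V, forall v, exists a : 'I_n -> k,
    P (v - \sum_i a i *: e i).
have : exists n, `[< span n >] by have [n h] := hP; exists n; apply/asboolP.
move/ex_minnP => [n /asboolP[e he] nmin].
have inj a : P (\sum_i a i *: e i) -> forall i, a i = 0.
  move=> Pa i; apply/eqP; apply/negPn/negP => ai.
  case: n e he nmin a Pa i ai => [|n] e he nmin a Pa i ai; first by case: i ai.
  suff : `[< span n >] by move=> /nmin; rewrite ltnn.
  apply/asboolP; exists (fun j => e (lift i j)) => v.
  have [b Pb] := he v.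
  exists (fun j => b (lift i j) - b i / a i * a (lift i j)).
  have := subspaceD sP Pb (subspaceZ (b i / a i) sP Pa).
  congr P; rewrite -addrA; congr (_ + _).
  rewrite !(bigD1_ord i) //= scalerDr scalerA divfK // opprD.
  under [in RHS]eq_bigr do rewrite scalerBl -scalerA.
  rewrite sumrB -scaler_sumr opprB [- (_ *: _) - _]addrC addrA.
  by rewrite -[X in X + _]addrA addNr addr0 addrC.
have [f hf] := choice he.
have uniq a v : P (v - \sum_i a i *: e i) -> forall i, f v i = a i.
  move=> Pa i; apply/eqP; rewrite -subr_eq0; apply/eqP.
  apply: (inj (fun i => f v i - a i)).
  under eq_bigr do rewrite scalerBl.
  rewrite sumrB.
  have := subspaceB sP Pa (hf v); congr P.
  by rewrite opprB addrC addrA subrK.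
exists n, e, (fun i v => f v i); split=> //.
- move=> i a x y; apply: (uniq (fun i => a * f x i + f y i) (a *: x + y)).
  under eq_bigr do rewrite scalerDl -scalerA.
  rewrite big_split /= -scaler_sumr.
  have := subspaceD sP (subspaceZ a sP (hf x)) (hf y); congr P.
  by rewrite scalerBr opprD addrACA.
- move=> v Pv i; apply: (uniq (fun=> 0)).
  by rewrite big1 ?subr0 // => j _; rewrite scale0r.
Qed.
End Subspace.

Section FiniteDual.
Variables (k : fieldType) (A : algType k).

(* The functionals vanishing on a two-sided ideal of finite codimension. *)
Definition in_finite_dual (f : A -> k^o) : Prop :=
  linear f /\ exists I : set A,
    [/\ two_sided_ideal I, finite_codim I & forall x, I x -> f x = 0].

Definition finite_dual_pred : {pred A -> k^o} :=
  fun f => `[< in_finite_dual f >].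

Record finite_dual := FiniteDual {
  fd_fun :> A -> k^o;
  _ : fd_fun \in finite_dual_pred
}.

(* r is a (possibly non-unital) matrix representation of A with index set T. *)
Definition mxcoef (T : finType) (r : T -> T -> A -> k) : Prop :=
  (forall i j, @lin k A k^o (r i j)) /\
  (forall i j x y, r i j (x * y) = \sum_l r i l x * r l j y).

Lemma in_finite_dualP (f : A -> k^o) : in_finite_dual f <->
  exists (T : finType) (r : T -> T -> A -> k) (c : T -> T -> k),
    mxcoef r /\ forall x, f x = \sum_i \sum_j c i j * r i j x.
Proof.
split=> [[lf [I [[sI iI] cI f0]]]|[T [r [c [[lr mr] fE]]]]].
  have [n [e [g [lg Ig g0]]]] := finite_codim_basis sI cI.
  have geq i x y : I (x - y) -> g i x = g i y.
    move=> Ixy; rewrite -[x](subrK y) (linearDP (lg i)) (g0 _ Ixy).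
    by rewrite add0r.
  exists 'I_n, (fun i j x => g i (x * e j)), (fun i j => f (e i) * g j 1).
  split; first split.
  - by move=> i j; apply: (lin_comp (lg i)); lin.
  - move=> i j x y /=.
    rewrite -mulrA (geq _ _ (x * (\sum_l g l (y * e j) *: e l))); last first.
      by rewrite -mulrBr; case: (iI x _ (Ig (y * e j))).
    rewrite mulr_sumr.
    elim/big_rec2: _ => [|l a b _ IH]; first exact: (linear0P (lg i)).
    rewrite (linearDP (lg i)) IH; congr (_ + _).
    by rewrite -scalerAr (linearZP _ (lg i)) /GRing.scale /= mulrC.
  - have feq x y : I (x - y) -> f x = f y.
      by move=> /f0; rewrite (linearDP lf x) -scaleN1r (linearZP _ lf) scaleN1r
         => /eqP; rewrite subr_eq0 => /eqP.
    have fs (v : A) : f v = \sum_i g i v * f (e i).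
      rewrite (feq _ _ (Ig v)).
      elim/big_rec2: _ => [|l a b _ IH]; first exact: (linear0P lf).
      by rewrite (linearDP lf) IH (linearZP _ lf).
    have gs i x : g i x = \sum_j g j 1 * g i (x * e j).
      rewrite (geq _ _ (x * (\sum_l g l 1 *: e l))); last first.
        by rewrite -{1}[x]mulr1 -mulrBr; case: (iI x _ (Ig 1)).
      rewrite mulr_sumr.
      elim/big_rec2: _ => [|l a b _ IH]; first exact: (linear0P (lg i)).
      rewrite (linearDP (lg i)) IH; congr (_ + _).
      by rewrite -scalerAr (linearZP _ (lg i)).
    move=> x; rewrite fs; apply: eq_bigr => i _.
    rewrite gs mulr_suml; apply: eq_bigr => j _.
    by rewrite mulrC mulrA.
split.
  move=> a x y; rewrite !fE scaler_sumr -big_split /=; apply: eq_bigr => i _.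
  rewrite scaler_sumr -big_split /=; apply: eq_bigr => j _.
  by rewrite lr mulrDr /GRing.scale /= mulrCA.
exists [set x | forall p : T * T, r p.1 p.2 x = 0]; split.
- split; first split.
  + by move=> p; exact: linear0P (lr _ _).
  + by move=> a x y hx hy p; rewrite lr hx hy scaler0 addr0.
  + move=> a x hx; split=> p; rewrite mr big1 // => l _.
      by rewrite (hx (l, p.2)) mulr0.
    by rewrite (hx (p.1, l)) mul0r.
- by apply: (@finite_codim_ker _ _ _ (fun (p : T * T) => r p.1 p.2)) => p; exact: lr.
- move=> x hx; rewrite fE big1 // => i _; rewrite big1 // => j _.
  by rewrite (hx (i, j)) mulr0.
Qed.

HB.instance Definition _ := [isSub for fd_fun].
HB.instance Definition _ := [Choice of finite_dual by <:].

Lemma finite_dual_submod : submod_closed finite_dual_pred.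
Proof.
split=> [|a f g /asboolP /in_finite_dualP [T [r [c [[lr mr] fE]]]]
    /asboolP /in_finite_dualP [T' [r' [c' [[lr' mr'] gE]]]]].
  apply/asboolP; split=> [b x y|]; first by rewrite /= scaler0 addr0.
  exists setT; split=> //.
  by exists 0, (fun _ => 0) => v; exists (fun _ => 0).
apply/asboolP/in_finite_dualP.
exists (T + T')%type, (fun i j => match i, j with
  | inl i, inl j => r i j | inr i, inr j => r' i j | _, _ => fun=> 0 end),
  (fun i j => match i, j with
  | inl i, inl j => a * c i j | inr i, inr j => c' i j | _, _ => 0 end).
split; first split.
- move=> [i|i] [j|j] //; try exact: lr; try exact: lr'.
    by move=> b x y; rewrite scaler0 addr0.
  by move=> b x y; rewrite scaler0 addr0.
- move=> [i|i] [j|j] x y; rewrite big_sumType /=.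
  + by rewrite mr [X in _ + X]big1 ?addr0 // => l _; rewrite mul0r.
  + rewrite big1 => [|l _]; last by rewrite ?mul0r ?mulr0.
    by rewrite add0r big1 // => l _; rewrite ?mul0r ?mulr0.
  + rewrite big1 => [|l _]; last by rewrite ?mul0r ?mulr0.
    by rewrite add0r big1 // => l _; rewrite ?mul0r ?mulr0.
  + by rewrite mr' [X in X + _]big1 ?add0r // => l _; rewrite mul0r.
- move=> x; have -> : (a *: f + g) x = a *: f x + g x by [].
  rewrite big_sumType /= fE gE scaler_sumr; congr (_ + _).
    apply: eq_bigr => i _; rewrite big_sumType /= [X in _ + X]big1 ?addr0.
      by rewrite scaler_sumr; apply: eq_bigr => j _; exact: mulrA.
    by move=> l _; rewrite mul0r.
  apply: eq_bigr => i _; rewrite big_sumType /= [X in _ = X + _]big1 ?add0r //.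
  by move=> l _; rewrite mul0r.
Qed.

HB.instance Definition _ :=
  GRing.isSubmodClosed.Build k (A -> k^o) finite_dual_pred finite_dual_submod.
HB.instance Definition _ := [SubChoice_isSubLmodule of finite_dual by <:].

Lemma fdP (f : finite_dual) : in_finite_dual f.
Proof. by have := valP f => /asboolP. Qed.

Lemma fd_linear (f : finite_dual) : linear f.
Proof. by case: (fdP f). Qed.

Lemma fd_ext (f g : finite_dual) : (forall x, f x = g x) -> f = g.
Proof. by move=> E; apply/val_inj/funext. Qed.

Lemma fdDE (f g : finite_dual) x : (f + g) x = f x + g x. Proof. by []. Qed.
Lemma fdZE a (f : finite_dual) x : (a *: f) x = a * f x. Proof. by []. Qed.
Lemma fd0E x : (0 : finite_dual) x = 0. Proof. by []. Qed.

Lemma lin_eval x : @lin k finite_dual k^o (fun f => f x).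
Proof. by []. Qed.

Lemma fd_mxcoef (T : finType) (r : T -> T -> A -> k) i j : mxcoef r ->
  (r i j : A -> k^o) \in finite_dual_pred.
Proof.
move=> hr; apply/asboolP/in_finite_dualP.
exists T, r, (fun i' j' => ((i' == i) && (j' == j))%:R); split=> // x.
rewrite (bigD1 i) //= (bigD1 j) //= !eqxx mul1r !big1 ?addr0 //.
  move=> i' ni; rewrite big1 // => j' _; rewrite (negbTE ni) mul0r //.
by move=> j' nj; rewrite (negbTE nj) andbF mul0r.
Qed.

Lemma fd_coprod (f : finite_dual) :
  exists t : finite_dual ⊗ finite_dual,
  forall x y, \tsum_(f1 ⊗ f2 <- t) (f1 x * f2 y : k^o) = f (x * y).
Proof.
have /in_finite_dualP [T [r [c [hr fE]]]] := fdP f.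
pose R i j : finite_dual := FiniteDual (fd_mxcoef i j hr).
exists (\sum_i \sum_j c i j *: \sum_l R i l ⊗ R l j) => x y.
have hB : @bilin k finite_dual finite_dual k^o (fun f1 f2 => f1 x * f2 y).
  by apply: bilinI => g; [apply: lin_mulkl|apply: lin_mulkr]; exact: lin_eval.
pose F (t : finite_dual ⊗ finite_dual) : k^o := \tsum_(f1 ⊗ f2 <- t) (f1 x * f2 y : k^o).
have lF : lin F := tlift_linear hB.
rewrite -/(F _) fE.
elim/big_rec2: _ => [|i a b _ <-]; first exact: linear0P lF.
rewrite (linearDP lF); congr (_ + _).
elim/big_rec2: _ => [|j a' b' _ <-]; first exact: linear0P lF.
rewrite (linearDP lF) (linearZP _ lF) hr.2; congr (_ * _ + _).
elim/big_rec2: _ => [|l a'' b'' _ <-]; first exact: linear0P lF.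
by rewrite (linearDP lF); congr (_ + _); rewrite /F tliftE.
Qed.

Definition ev2 (t : finite_dual ⊗ finite_dual) (x y : A) : k :=
  \tsum_(f1 ⊗ f2 <- t) (f1 x * f2 y : k^o).

Lemma ev2_linear x y : @lin k _ k^o (fun t => ev2 t x y).
Proof.
apply: tlift_linear.
by apply: bilinI => g; [apply: lin_mulkl|apply: lin_mulkr]; exact: lin_eval.
Qed.

Lemma ev2_inj t t' : (forall x y, ev2 t x y = ev2 t' x y) -> t = t'.
Proof.
move=> E; apply/eqP; rewrite -subr_eq0; apply/eqP.
apply: (@tens_sep k finite_dual finite_dual A A
  (fun x (f : finite_dual) => f x) (fun x (f : finite_dual) => f x)).
- exact: lin_eval.
- exact: lin_eval.
- by move=> f f0; apply: fd_ext.
- by move=> f f0; apply: fd_ext.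
move=> x y; rewrite -/(ev2 _ x y) (linearDP (ev2_linear x y)) E.
by rewrite -scaleN1r (linearZP _ (ev2_linear x y)) scaleN1r subrr.
Qed.

Lemma ev2_tens (f g : finite_dual) x y : ev2 (f ⊗ g) x y = f x * g y.
Proof.
rewrite /ev2 tliftE //.
by apply: bilinI => h; [apply: lin_mulkl|apply: lin_mulkr]; exact: lin_eval.
Qed.

Lemma ev2_tsum (U V : lmodType k) (t : U ⊗ V) B x y :
  ev2 (tlift t B) x y = \tsum_(u ⊗ v <- t) (ev2 (B u v) x y : k^o).
Proof. exact: (lin_tsum _ _ (ev2_linear x y)). Qed.

Lemma fd_tsumE (U V : lmodType k) (t : U ⊗ V) (B : U -> V -> finite_dual) x :
  (tlift t B) x = \tsum_(u ⊗ v <- t) (B u v x : k^o).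
Proof. exact: (lin_tsum _ _ (@lin_eval x)). Qed.

Definition ev3 (t : finite_dual ⊗ (finite_dual ⊗ finite_dual)) (x y z : A) : k :=
  \tsum_(f1 ⊗ f23 <- t) (f1 x * ev2 f23 y z : k^o).

Lemma ev3_bilin x y z : @bilin k finite_dual (finite_dual ⊗ finite_dual)%type k^o
  (fun f1 f23 => f1 x * ev2 f23 y z).
Proof.
apply: bilinI => g; [apply: lin_mulkl; exact: lin_eval|apply: lin_mulkr].
exact: ev2_linear.
Qed.

Lemma ev3_linear x y z : @lin k _ k^o (fun t => ev3 t x y z).
Proof. exact: tlift_linear (ev3_bilin x y z). Qed.

Lemma ev3_inj t t' : (forall x y z, ev3 t x y z = ev3 t' x y z) -> t = t'.
Proof.
move=> E; apply/eqP; rewrite -subr_eq0; apply/eqP.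
apply: (@tens_sep k finite_dual (finite_dual ⊗ finite_dual)%type A (A * A)%type
  (fun x (f : finite_dual) => f x)
  (fun p (t : finite_dual ⊗ finite_dual) => ev2 t p.1 p.2)).
- exact: lin_eval.
- by move=> p; exact: ev2_linear.
- by move=> f f0; apply: fd_ext.
- move=> s s0; apply: ev2_inj => x y; rewrite (s0 (x, y)).
  by rewrite (linear0P (ev2_linear x y)).
move=> x [y z]; rewrite -/(ev3 _ x y z) (linearDP (ev3_linear x y z)) E.
by rewrite -scaleN1r (linearZP _ (ev3_linear x y z)) scaleN1r subrr.
Qed.

Lemma ev3_tens f t x y z : ev3 (f ⊗ t) x y z = f x * ev2 t y z.
Proof. by rewrite /ev3 tliftE //; exact: ev3_bilin. Qed.

Lemma ev3_tsum (U V : lmodType k) (t : U ⊗ V) B x y z :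
  ev3 (tlift t B) x y z = \tsum_(u ⊗ v <- t) (ev3 (B u v) x y z : k^o).
Proof. exact: (lin_tsum _ _ (ev3_linear x y z)). Qed.

(* The unique t = f1 ⊗ f2 with f1(x) f2(y) = f(xy); see fd_coprod for existence
   and ev2_inj for uniqueness. *)
Definition fd_comul (f : finite_dual) : finite_dual ⊗ finite_dual :=
  xget 0 [set t : finite_dual ⊗ finite_dual | forall x y,
    \tsum_(f1 ⊗ f2 <- t) (f1 x * f2 y : k^o) = f (x * y)].

Lemma fd_comulE f x y : ev2 (fd_comul f) x y = f (x * y).
Proof.
have := @xgetPex (finite_dual ⊗ finite_dual)%type 0 _ (fd_coprod f).
exact.
Qed.

Lemma fd_comul_linear : linear fd_comul.
Proof.
move=> a f g; apply: ev2_inj => x y.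
by rewrite ev2_linear !fd_comulE.
Qed.
HB.instance Definition _ := GRing.isLinear.Build k finite_dual
  (finite_dual ⊗ finite_dual)%type _ fd_comul fd_comul_linear.

Definition fd_counit (f : finite_dual) : k := f 1.
Lemma fd_counit_scalar : scalar fd_counit. Proof. by []. Qed.
HB.instance Definition _ := GRing.isLinear.Build k finite_dual
  k _ fd_counit fd_counit_scalar.

Lemma fd_comulA (f : finite_dual) :
  \tsum_(c1 ⊗ c2 <- fd_comul f) \tsum_(c11 ⊗ c12 <- fd_comul c1) c11 ⊗ (c12 ⊗ c2) =
  \tsum_(c1 ⊗ c2 <- fd_comul f) c1 ⊗ fd_comul c2.
Proof.
apply: ev3_inj => x y z; rewrite !ev3_tsum.
transitivity (f (x * y * z)).
  rewrite -fd_comulE [RHS]/ev2; apply: (@eq_tlift k finite_dual finite_dual k^o) => f1 f2.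
  rewrite ev3_tsum -fd_comulE.
  transitivity (\tsum_(f11 ⊗ f12 <- fd_comul f1) ((f11 x * f12 y) * f2 z : k^o)).
    by apply: eq_tlift => f11 f12; rewrite ev3_tens ev2_tens mulrA.
  by rewrite /ev2 /tlift mulr_suml.
rewrite -mulrA -fd_comulE; apply: (@eq_tlift k finite_dual finite_dual k^o) => f1 f2.
by rewrite ev3_tens fd_comulE.
Qed.

Lemma fd_counitl (f : finite_dual) :
  \tsum_(c1 ⊗ c2 <- fd_comul f) fd_counit c1 *: c2 = f.
Proof.
apply: fd_ext => x; rewrite fd_tsumE -[in RHS](mul1r x) -fd_comulE [RHS]/ev2.
exact: eq_tlift.
Qed.

Lemma fd_counitr (f : finite_dual) :
  \tsum_(c1 ⊗ c2 <- fd_comul f) fd_counit c2 *: c1 = f.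
Proof.
apply: fd_ext => x; rewrite fd_tsumE -[in RHS](mulr1 x) -fd_comulE [RHS]/ev2.
by apply: eq_tlift => f1 f2; rewrite fdZE mulrC.
Qed.

HB.instance Definition _ := Lmodule_isCoalgebra.Build k finite_dual
  fd_comulA fd_counitl fd_counitr.

End FiniteDual.

Section FiniteDualHopf.
Variables (k : fieldType) (H : hopfType k).
Local Notation Hd := (finite_dual H).

Lemma counit_in_finite_dual :
  (counit : H -> k^o) \in finite_dual_pred (A := H).
Proof.
apply/asboolP/in_finite_dualP.
exists 'I_1, (fun _ _ => counit), (fun _ _ => 1); split; last first.
  by move=> x; rewrite !big_ord1 mul1r.
split; first by move=> _ _; exact: scalar_lin.
by move=> _ _ x y; rewrite big_ord1 counitM.
Qed.

Definition fd_one : Hd := FiniteDual counit_in_finite_dual.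

Lemma conv_in_finite_dual (f g : Hd) :
  (fun x => \tsum_(x1 ⊗ x2 <- comul x) (f x1 * g x2 : k^o)) \in
    finite_dual_pred (A := H).
Proof.
have /in_finite_dualP [T [r [c [[lr mr] fE]]]] := fdP f.
have /in_finite_dualP [T' [r' [c' [[lr' mr'] gE]]]] := fdP g.
have hB i j i' j' : @bilin k H H k^o (fun x1 x2 => r i j x1 * r' i' j' x2).
  by apply: bilinI => x; [apply: lin_mulkl|apply: lin_mulkr].
apply/asboolP/in_finite_dualP.
exists (T * T')%type, (fun i j x =>
   \tsum_(x1 ⊗ x2 <- comul x) (r i.1 j.1 x1 * r' i.2 j.2 x2 : k^o)),
  (fun i j => c i.1 j.1 * c' i.2 j.2).
split; first split.
- by move=> i j; apply: lin_tlift => //; exact: linear_lin.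
- move=> [i i'] [j j'] x y /=; rewrite comulM.
  rewrite (lin_tsum _ _ (tlift_linear (hB i j i' j'))).
  under eq_tlift => x1 x2.
    rewrite (lin_tsum _ _ (tlift_linear (hB i j i' j'))).
    under eq_tlift => y1 y2.
      rewrite tliftE // mr mr'.
      over.
    over.
  rewrite /tlift.
  under [RHS]eq_bigr do rewrite big_distrlr /=.
  rewrite [RHS]exchange_big; apply: eq_bigr => p _ /=.
  rewrite [RHS]exchange_big; apply: eq_bigr => q _ /=.
  rewrite big_distrlr /= -(pair_bigA _ (fun l l' => r i l p.1 * r' i' l' p.2 *
    (r l j q.1 * r' l' j' q.2))) /=.
  by apply: eq_bigr => l _; apply: eq_bigr => l' _; rewrite mulrACA.
- move=> x; rewrite /tlift.
  under [LHS]eq_bigr do rewrite fE gE big_distrlr /=.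
  under [RHS]eq_bigr do under eq_bigr do rewrite mulr_sumr.
  under [RHS]eq_bigr do rewrite exchange_big.
  rewrite [RHS]exchange_big; apply: eq_bigr => p _ /=.
  rewrite -(pair_bigA _ (fun i i' => \sum_(i0 : T * T') c i i0.1 * c' i' i0.2 *
     (r i i0.1 p.1 * r' i' i0.2 p.2))) /=.
  apply: eq_bigr => i _; apply: eq_bigr => i' _.
  rewrite big_distrlr /= -(pair_bigA _ (fun j j' => c i j * c' i' j' *
     (r i j p.1 * r' i' j' p.2))) /=.
  by apply: eq_bigr => l _; apply: eq_bigr => l' _; rewrite mulrACA.
Qed.

Definition fd_mul (f g : Hd) : Hd := FiniteDual (conv_in_finite_dual f g).

Lemma antip_in_finite_dual (f : Hd) :
  (fun x => f (antipode x)) \in finite_dual_pred (A := H).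
Proof.
have /in_finite_dualP [T [r [c [[lr mr] fE]]]] := fdP f.
apply/asboolP/in_finite_dualP.
exists T, (fun i j x => r j i (antipode x)), (fun i j => c j i).
split; first split.
- by move=> i j; apply: (lin_comp (lr j i)); exact: linear_lin.
- move=> i j x y; rewrite antipodeM mr; apply: eq_bigr => l _; exact: mulrC.
- by move=> x; rewrite fE exchange_big.
Qed.

Definition fd_antipode (f : Hd) : Hd := FiniteDual (antip_in_finite_dual f).

Lemma fd_lin (f : Hd) : @lin k H k^o f.
Proof. exact: (fd_linear f). Qed.

Lemma fd_bilin (f g : Hd) : @bilin k H H k^o (fun x y => f x * g y).
Proof.
by apply: bilinI => x; [apply: lin_mulkl|apply: lin_mulkr]; exact: fd_lin.
Qed.

Lemma fd_mulA : associative fd_mul.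
Proof.
move=> f g h; apply: fd_ext => x /=.
transitivity (\tsum_(x1 ⊗ x2 <- comul x) \tsum_(x21 ⊗ x22 <- comul x2)
   (f x1 * (g x21 * h x22) : k^o)).
  by apply: eq_tlift => x1 x2; rewrite /tlift /= mulr_sumr.
rewrite -coassoc3 //; first last.
- by move=> a b; apply: lin_mulkl; exact: fd_lin.
- by move=> a b; apply: lin_mulkr; apply: lin_mulkl; exact: fd_lin.
- by move=> a b; do 2! apply: lin_mulkr; exact: fd_lin.
apply: eq_tlift => x1 x2; rewrite /tlift /= mulr_suml.
by apply: eq_bigr => p _; rewrite mulrA.
Qed.

Lemma fd_mul1 : left_id fd_one fd_mul.
Proof.
move=> f; apply: fd_ext => x /=; rewrite -[in RHS](counitl x).
rewrite (lin_tsum _ _ (fd_lin f)); apply: eq_tlift => x1 x2.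
by rewrite (linearZP _ (fd_lin f)).
Qed.

Lemma fd_mulr1 : right_id fd_one fd_mul.
Proof.
move=> f; apply: fd_ext => x /=; rewrite -[in RHS](counitr x).
rewrite (lin_tsum _ _ (fd_lin f)); apply: eq_tlift => x1 x2.
by rewrite (linearZP _ (fd_lin f)) mulrC.
Qed.

Lemma fd_mulDl : left_distributive fd_mul +%R.
Proof.
move=> f g h; apply: fd_ext => x.
rewrite fdDE /= /tlift -big_split; apply: eq_bigr => p _ /=.
exact: mulrDl.
Qed.

Lemma fd_mulDr : right_distributive fd_mul +%R.
Proof.
move=> f g h; apply: fd_ext => x.
rewrite fdDE /= /tlift -big_split; apply: eq_bigr => p _ /=.
exact: mulrDr.
Qed.

Lemma fd_one_neq0 : fd_one != 0.
Proof.
apply/eqP => /(congr1 (fun f : Hd => f 1)) /=; rewrite counit1 => /eqP.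
by rewrite oner_eq0.
Qed.

HB.instance Definition _ := GRing.Zmodule_isNzRing.Build (finite_dual H)
  fd_mulA fd_mul1 fd_mulr1 fd_mulDl fd_mulDr fd_one_neq0.

Lemma fd_mulE (f g : Hd) x :
  (f * g) x = \tsum_(x1 ⊗ x2 <- comul x) (f x1 * g x2 : k^o).
Proof. by []. Qed.

Lemma fd_scalerAl (a : k) (f g : Hd) : a *: (f * g) = (a *: f) * g.
Proof.
apply: fd_ext => x; rewrite fdZE !fd_mulE /tlift mulr_sumr.
by apply: eq_bigr => p _; rewrite fdZE mulrA.
Qed.
HB.instance Definition _ :=
  GRing.Lmodule_isLalgebra.Build k (finite_dual H) fd_scalerAl.

Lemma fd_scalerAr (a : k) (f g : Hd) : a *: (f * g) = f * (a *: g).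
Proof.
apply: fd_ext => x; rewrite fdZE !fd_mulE /tlift mulr_sumr.
by apply: eq_bigr => p _; rewrite fdZE mulrCA.
Qed.
HB.instance Definition _ :=
  GRing.Lalgebra_isAlgebra.Build k (finite_dual H) fd_scalerAr.

Lemma fd_oneE x : (1 : Hd) x = counit x. Proof. by []. Qed.

Lemma fd_comul1 : comul (1 : Hd) = 1 ⊗ 1.
Proof.
apply: ev2_inj => x y; rewrite ev2_tens [LHS]fd_comulE; exact: counitM.
Qed.

Lemma fd_comulM (f g : Hd) : comul (f * g) =
  \tsum_(f1 ⊗ f2 <- comul f) \tsum_(g1 ⊗ g2 <- comul g) (f1 * g1) ⊗ (f2 * g2).
Proof.
apply: ev2_inj => x y; rewrite [LHS]fd_comulE fd_mulE comulM.
have lF := tlift_linear (fd_bilin f g).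
rewrite (lin_tsum _ _ lF) ev2_tsum.
transitivity (\tsum_(x1 ⊗ x2 <- comul x) \tsum_(y1 ⊗ y2 <- comul y)
  \tsum_(f1 ⊗ f2 <- comul f) \tsum_(g1 ⊗ g2 <- comul g)
   (f1 x1 * f2 y1 * (g1 x2 * g2 y2) : k^o)).
  apply: (@eq_tlift k _ _ k^o) => x1 x2; rewrite (lin_tsum _ _ lF).
  apply: (@eq_tlift k _ _ k^o) => y1 y2; rewrite tliftE; last exact: fd_bilin.
  rewrite -!fd_comulE /ev2 /tlift big_distrlr /=.
  by apply: eq_bigr => p _; apply: eq_bigr => q _.
under eq_tlift => x1 x2 do rewrite exchange_tlift.
rewrite exchange_tlift; apply: (@eq_tlift k _ _ k^o) => f1 f2.
under eq_tlift => x1 x2 do rewrite exchange_tlift.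
rewrite exchange_tlift ev2_tsum; apply: (@eq_tlift k _ _ k^o) => g1 g2.
rewrite ev2_tens !fd_mulE /tlift big_distrlr /=.
apply: eq_bigr => p _; apply: eq_bigr => q _; exact: mulrACA.
Qed.

Lemma fd_counit1 : counit (1 : Hd) = 1.
Proof. exact: counit1. Qed.

Lemma fd_counitM (f g : Hd) : counit (f * g) = counit f * counit g.
Proof.
rewrite [LHS](_ : _ = (f * g) 1) // fd_mulE comul1 tliftE //.
exact: fd_bilin.
Qed.

HB.instance Definition _ := Algebra_Coalgebra_isBialgebra.Build k (finite_dual H)
  fd_comul1 fd_comulM fd_counit1 fd_counitM.

Lemma fd_antipode_linear : linear fd_antipode.
Proof. by move=> a f g; apply: fd_ext. Qed.
HB.instance Definition _ := GRing.isLinear.Build k (finite_dual H)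
  (finite_dual H) _ fd_antipode fd_antipode_linear.

Lemma fd_antipodel (f : Hd) :
  \tsum_(f1 ⊗ f2 <- comul f) fd_antipode f1 * f2 = (counit f)%:A.
Proof.
apply: fd_ext => x; rewrite fd_tsumE fdZE fd_oneE.
transitivity (\tsum_(x1 ⊗ x2 <- comul x) (f (antipode x1 * x2) : k^o)).
  under eq_tlift => f1 f2 do rewrite fd_mulE.
  by rewrite exchange_tlift; apply: (@eq_tlift k _ _ k^o) => x1 x2; rewrite -fd_comulE.
rewrite -(lin_tsum _ _ (fd_lin f)) antipodel (linearZP _ (fd_lin f)).
exact: mulrC.
Qed.

Lemma fd_antipoder (f : Hd) :
  \tsum_(f1 ⊗ f2 <- comul f) f1 * fd_antipode f2 = (counit f)%:A.
Proof.
apply: fd_ext => x; rewrite fd_tsumE fdZE fd_oneE.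
transitivity (\tsum_(x1 ⊗ x2 <- comul x) (f (x1 * antipode x2) : k^o)).
  under eq_tlift => f1 f2 do rewrite fd_mulE.
  by rewrite exchange_tlift; apply: (@eq_tlift k _ _ k^o) => x1 x2; rewrite -fd_comulE.
rewrite -(lin_tsum _ _ (fd_lin f)) antipoder (linearZP _ (fd_lin f)).
exact: mulrC.
Qed.

HB.instance Definition _ := Bialgebra_isHopf.Build k (finite_dual H)
  fd_antipodel fd_antipoder.
End FiniteDualHopf.

Section Comodules.
Variables (k : fieldType) (H : hopfType k).

Definition comodule_coalgebra (D : coalgType k)
    (lambda : {linear D -> (H ⊗ D)%type}) : Prop :=
  [/\ forall d, \tsum_(h ⊗ d' <- lambda d) counit h *: d' = d,
      forall d, \tsum_(h ⊗ d' <- lambda d) h ⊗ comul d' =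
        \tsum_(d1 ⊗ d2 <- comul d)
          \tsum_(h1 ⊗ e1 <- lambda d1) \tsum_(h2 ⊗ e2 <- lambda d2)
            (h1 * h2) ⊗ (e1 ⊗ e2) &
      forall d, \tsum_(h ⊗ d' <- lambda d) h ⊗ lambda d' =
        \tsum_(h ⊗ d' <- lambda d) \tsum_(h1 ⊗ h2 <- comul h)
          h1 ⊗ (h2 ⊗ d')].

(* (I ⊗ counit) lambda, after the identification H ⊗ k = H. *)
Definition nabla (C : coalgType k) (lambda : {linear C -> (H ⊗ C)%type})
    (c : C) : H :=
  \tsum_(h ⊗ c' <- lambda c) counit c' *: h.

Definition partial_comodule_coalgebra (C : coalgType k)
    (lambda : {linear C -> (H ⊗ C)%type}) : Prop :=
  [/\ forall c, \tsum_(h ⊗ c' <- lambda c) counit h *: c' = c,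
      forall c, \tsum_(h ⊗ c' <- lambda c) h ⊗ comul c' =
        \tsum_(c1 ⊗ c2 <- comul c)
          \tsum_(h1 ⊗ e1 <- lambda c1) \tsum_(h2 ⊗ e2 <- lambda c2)
            (h1 * h2) ⊗ (e1 ⊗ e2) &
      forall c, \tsum_(h ⊗ c' <- lambda c) h ⊗ lambda c' =
        \tsum_(c1 ⊗ c2 <- comul c)
          \tsum_(h ⊗ c' <- lambda c2) \tsum_(h1 ⊗ h2 <- comul h)
            (nabla lambda c1 * h1) ⊗ (h2 ⊗ c')].

End Comodules.

Definition coalgebra_mono (k : fieldType) (C D : coalgType k)
    (theta : {linear C -> D}) : Prop :=
  [/\ injective theta,
      forall c, comul (theta c) =
        \tsum_(c1 ⊗ c2 <- comul c) theta c1 ⊗ theta c2 &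
      forall c, counit (theta c) = counit c].

(* pi is a comultiplicative projection from D onto theta(C); no compatibility
   with the counit is required. *)
Definition comul_projection (k : fieldType) (C D : coalgType k)
    (theta : {linear C -> D}) (pi : {linear D -> D}) : Prop :=
  [/\ forall d, pi (pi d) = pi d,
      range pi = range theta &
      forall d, comul (pi d) = \tsum_(d1 ⊗ d2 <- comul d) pi d1 ⊗ pi d2].

(* The subspace P ⊗ Q of U ⊗ V, for subspaces P of U and Q of V. *)
Definition sub_tensor (k : fieldType) (U V : lmodType k)
    (P : set U) (Q : set V) : set (U ⊗ V) :=
  [set t | exists s : seq (U * V),
     (forall p, p \in s -> P p.1 /\ Q p.2) /\ t = \sum_(p <- s) p.1 ⊗ p.2].

Definition subcomodule_coalgebra (k : fieldType) (H : hopfType k)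
    (D : coalgType k) (lambda : {linear D -> (H ⊗ D)%type})
    (P : set D) : Prop :=
  [/\ is_subspace P,
      forall d, P d -> sub_tensor P P (comul d) &
      forall d, P d -> sub_tensor setT P (lambda d)].

Record comodule_globalization (k : fieldType) (H : hopfType k)
    (C D : coalgType k) (lambda' : {linear C -> (H ⊗ C)%type})
    (lambda : {linear D -> (H ⊗ D)%type})
    (theta : {linear C -> D}) (pi : {linear D -> D}) : Prop := {
  cg_comodule : comodule_coalgebra lambda;
  cg_mono : coalgebra_mono theta;
  cg_projection : comul_projection theta pi;
  cg_compat : forall x, range theta x ->
    \tsum_(h ⊗ d <- lambda x) h ⊗ (\tsum_(g ⊗ e <- lambda (pi d)) g ⊗ pi e) =
    \tsum_(h ⊗ d <- lambda x) h ⊗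
      (\tsum_(d1 ⊗ d2 <- comul d) \tsum_(g ⊗ e <- lambda d2)
         g ⊗ (counit (pi d1) *: pi e));
  cg_equiv : forall c,
    \tsum_(h ⊗ d <- lambda (theta c)) h ⊗ pi d =
    \tsum_(h ⊗ c' <- lambda' c) h ⊗ theta c';
  cg_generated : forall P : set D, subcomodule_coalgebra lambda P ->
    range theta `<=` P -> P = setT
}.

Section Modules.
Variables (k : fieldType) (K : hopfType k).

Definition module_coalgebra (D : coalgType k) (act : D -> K -> D) : Prop :=
  [/\ bilin act,
      forall d, act d 1 = d,
      forall d h, comul (act d h) =
        \tsum_(d1 ⊗ d2 <- comul d) \tsum_(h1 ⊗ h2 <- comul h)
          act d1 h1 ⊗ act d2 h2 &
      forall d h g, act (act d h) g = act d (h * g)].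

Definition partial_module_coalgebra (C : coalgType k) (act : C -> K -> C)
    : Prop :=
  [/\ bilin act,
      forall c, act c 1 = c,
      forall c h, comul (act c h) =
        \tsum_(c1 ⊗ c2 <- comul c) \tsum_(h1 ⊗ h2 <- comul h)
          act c1 h1 ⊗ act c2 h2 &
      forall c h g, act (act c h) g =
        \tsum_(c1 ⊗ c2 <- comul c) \tsum_(h1 ⊗ h2 <- comul h)
          counit (act c1 h1) *: act c2 (h2 * g)].

Record module_globalization (C D : coalgType k) (pact : C -> K -> C)
    (act : D -> K -> D) (theta : {linear C -> D}) (pi : {linear D -> D})
    : Prop := {
  mg_module : module_coalgebra act;
  mg_mono : coalgebra_mono theta;
  mg_projection : comul_projection theta pi;
  mg_compat : forall h d,
    pi (act (pi d) h) =
    pi (\tsum_(d1 ⊗ d2 <- comul d) counit (pi d1) *: act d2 h);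
  mg_equiv : forall c h, theta (pact c h) = pi (act (theta c) h);
  mg_generated : forall d, exists s : seq (C * K),
    d = \sum_(p <- s) act (theta p.1) p.2
}.

End Modules.

Definition finite_dual_separates_points (k : fieldType) (H : hopfType k)
    : Prop :=
  forall h : H, (forall f : finite_dual H, f h = 0) -> h = 0.

Definition dual_action (k : fieldType) (H : hopfType k) (V : lmodType k)
    (lambda : {linear V -> (H ⊗ V)%type}) (v : V) (f : finite_dual H) : V :=
  \tsum_(h ⊗ v' <- lambda v) f h *: v'.

(* Main.v *)
Require Import Defs.
From mathcomp Require Import all_boot all_algebra.
From mathcomp Require Import boolp classical_sets functions.

(** The action of a functional f in H^0 on a comodule is the coaction followed
    by the contraction f ⊗ I.  Contracting the first one or two tensor factors
    of the comodule identities therefore gives module identities: comul of H^0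
    is dual to the product of H (contract_mul) and the product of H^0 is dual
    to comul of H (contract_conv), so the axioms of a comodule coalgebra become
    those of a module coalgebra, in the partial and in the global case alike.
    Condition (2) of a globalization is contracted in the same way.

    Generation is the step where H^0 has to separate points.  Let P be the span
    of the θ(c) ◂ f.  It is an H^0-submodule and a subcoalgebra containing θ(C),
    so it is all of D once it is known to be an H-subcomodule.  For d in P all
    contractions (f ⊗ I)(λ(d)) lie in P, and when the functionals f separate the
    points of H this forces λ(d) into H ⊗ P (sub_tensor_contract).

    Condition (1) is required on θ(C) only for comodules but on all of D for
    modules.  Contracting its first factor with g turns the assertion on
    x = θ(c) into the assertion on x ◂ g, and by generation the elements θ(c) ◂ g
    span D; so generation is used for condition (1) as well. *)

Set Implicit Arguments.
Unset Strict Implicit.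
Unset Printing Implicit Defensive.

Import GRing.Theory.
Local Open Scope ring_scope.
Local Open Scope classical_set_scope.

(** * Contraction of a tensor factor *)

Section Contraction.
Variables (k : fieldType) (U : lmodType k).
Implicit Types V W : lmodType k.

Definition contract V (f : U -> k) (t : U ⊗ V) : V :=
  \tsum_(u ⊗ v <- t) f u *: v.

Variables (f : U -> k) (lf : @lin k U k^o f).

Lemma contract_bilin V : bilin (fun (u : U) (v : V) => f u *: v).
Proof.
by apply: bilinI => [v|u]; [exact: lin_scalel|apply: lin_scaler; exact: lin_id].
Qed.

Lemma contract_lin V : lin (@contract V f).
Proof. exact: tlift_linear (contract_bilin V). Qed.

Lemma contract_tens V (u : U) (v : V) : contract f (u ⊗ v) = f u *: v.
Proof. exact: tliftE (contract_bilin V). Qed.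

Lemma contract_tsum (X Y : lmodType k) V (B : X -> Y -> U ⊗ V) t :
  contract f (tlift t B) = \tsum_(x ⊗ y <- t) contract f (B x y).
Proof. exact: lin_tsum (@contract_lin V). Qed.

(** Contraction is natural in the factor that is kept. *)
Lemma contract_map V W (G : V -> W) (t : U ⊗ V) : lin G ->
  contract f (\tsum_(u ⊗ v <- t) u ⊗ G v) = G (contract f t).
Proof.
move=> lG; rewrite contract_tsum [in RHS]/contract (lin_tsum _ _ lG).
by apply: eq_tlift => u v; rewrite contract_tens (linearZP _ lG).
Qed.
End Contraction.
Arguments contract_lin {k U f} lf {V}.

(** * Tensors whose contractions lie in a subspace *)

Section SubTensor.
Variables (k : fieldType) (U V : lmodType k).

Lemma sub_tensor_subspace (P : set U) (Q : set V) :
  is_subspace P -> is_subspace (sub_tensor P Q).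
Proof.
move=> sP; split; first by exists [::]; rewrite big_nil.
move=> a _ _ [s [hs ->]] [t [ht ->]].
exists ([seq (a *: p.1, p.2) | p <- s] ++ t); split.
  move=> p; rewrite mem_cat => /orP[/mapP[q qs ->]|/ht //].
  by have [Pq Qq] := hs q qs; split=> //=; exact: subspaceZ.
rewrite big_cat big_map /=; congr (_ + _).
rewrite scaler_sumr; apply: eq_bigr => p _.
by rewrite (linearZP _ (lin_tensl p.2 (@lin_id k U))).
Qed.

Lemma sub_tensor_tens (P : set U) (Q : set V) u v :
  P u -> Q v -> sub_tensor P Q (u ⊗ v).
Proof.
move=> Pu Qv; exists [:: (u, v)]; rewrite big_seq1; split=> // p.
by rewrite inE => /eqP->.
Qed.

(** The proof is an elimination on the length of an expression of t.  If
    F i u != 0 in the first term u ⊗ v, then w = (F i u)^-1 (F i ⊗ I)(t) is in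
    P, and t - u ⊗ w is a sum of one term less: replacing v by w amounts to
    subtracting multiples of u from the left components of the other terms.
    Its contractions differ from those of t by multiples of w. *)
Lemma sub_tensor_contract (I : Type) (F : I -> U -> k) (P : set V) (t : U ⊗ V) :
  (forall i, @lin k U k^o (F i)) ->
  (forall u, (forall i, F i u = 0) -> u = 0) ->
  is_subspace P -> (forall i, P (contract (F i) t)) -> sub_tensor setT P t.
Proof.
move=> lF sF sP ht.
have sT : is_subspace (@sub_tensor _ U V setT P) by exact: sub_tensor_subspace.
rewrite -(reprK t) tens_sum.
have {ht}: forall i, P (\sum_(p <- repr t) F i p.1 *: p.2) by exact: ht.
have [n] := ubnP (size (repr t)); elim: n (repr t) => // n IH.
case=> [|[u v] s] /=; first by rewrite big_nil; case: sT.
rewrite ltnS => ns hs; rewrite big_cons /=.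
have [u0|/eqP/(contra_not (sF u))/existsNP [i /eqP Fu]] := eqVneq u 0.
  rewrite u0 (linear0P (lin_tensl v (@lin_id k U))) add0r; apply: IH => // i.
  have := hs i.
  by rewrite big_cons /= u0 (linear0P (lF i)) scale0r add0r.
pose a p := F i p / F i u.
pose w := v + \sum_(p <- s) a p.1 *: p.2.
have Pw : P w.
  have := subspaceZ (F i u)^-1 sP (hs i); congr P.
  rewrite big_cons /= scalerDr scalerA mulVf // scale1r; congr (_ + _).
  by rewrite scaler_sumr; apply: eq_bigr => p _; rewrite scalerA mulrC.
pose s' := [seq (p.1 - a p.1 *: u, p.2) | p <- s].
have -> : u ⊗ v + \sum_(p <- s) p.1 ⊗ p.2 =
    u ⊗ w + \sum_(p <- s') p.1 ⊗ p.2.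
  have lu := lin_tensr u (@lin_id k V).
  rewrite /w (linearDP lu) big_map -addrA; congr (_ + _).
  have -> : u ⊗ (\sum_(p <- s) a p.1 *: p.2) = \sum_(p <- s) (a p.1 *: u) ⊗ p.2.
    elim: (s) => [|p l IHl]; first by rewrite !big_nil (linear0P lu).
    rewrite !big_cons (linearDP lu) IHl; congr (_ + _).
    by rewrite (linearZP _ lu) (linearZP _ (lin_tensl p.2 (@lin_id k U))).
  rewrite -big_split; apply: eq_bigr => p _ /=.
  by rewrite -(linearDP (lin_tensl p.2 (@lin_id k U))) addrC subrK.
apply: subspaceD => //; first exact: sub_tensor_tens.
apply: IH; first by rewrite size_map.
move=> j; have := subspaceB sP (hs j) (subspaceZ (F j u) sP Pw); congr P.
rewrite big_cons big_map /= /w scalerDr opprD addrACA subrr add0r.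
rewrite scaler_sumr -sumrB; apply: eq_bigr => p _.
rewrite -(scaleNr (a p.1) u) (linearDP (lF j)) (linearZP _ (lF j)) scalerA.
rewrite -scalerBl.
by congr (_ *: _); rewrite mulrC [_ *: _]mulNr.
Qed.
End SubTensor.

(** * Duality between the operations of H and those of its finite dual *)

Section Dual.
Variables (k : fieldType) (H : hopfType k).
Implicit Types (f g : finite_dual H) (V W : lmodType k).

Lemma contract_bilin_fd V :
  bilin (fun (t : H ⊗ V) f => contract f t).
Proof.
apply: bilinI => [f|t]; first exact (contract_lin (fd_lin f)).
apply: lin_tlift_body => h v; apply: lin_scalel; exact: lin_eval.
Qed.

Lemma dual_action_bilin V (lambda : {linear V -> (H ⊗ V)%type}) :
  bilin (dual_action lambda).
Proof.
have [l1 l2] := contract_bilin_fd V.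
apply: bilinI => [f|v]; last exact: l2.
exact: lin_comp (l1 f) (linear_lin lambda).
Qed.

Lemma contract_mul V W f (s : H ⊗ V) (t : H ⊗ W) :
  contract f (\tsum_(h1 ⊗ v <- s) \tsum_(h2 ⊗ w <- t) (h1 * h2) ⊗ (v ⊗ w)) =
  \tsum_(f1 ⊗ f2 <- comul f) contract f1 s ⊗ contract f2 t.
Proof.
have lf := fd_lin f.
transitivity (\tsum_(h1 ⊗ v <- s) \tsum_(h2 ⊗ w <- t)
    \tsum_(f1 ⊗ f2 <- comul f) ((f1 h1 : k) *: v) ⊗ ((f2 h2 : k) *: w)).
  rewrite contract_tsum //; apply: eq_tlift => h1 v.
  rewrite contract_tsum //; apply: eq_tlift => h2 w.
  rewrite contract_tens // -fd_comulE /ev2 /tlift scaler_suml.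
  apply: eq_bigr => p _.
  rewrite (linearZP _ (lin_tensl _ (@lin_id k V))).
  by rewrite (linearZP _ (lin_tensr _ (@lin_id k W))) scalerA.
under eq_tlift => h1 v do rewrite exchange_tlift.
rewrite exchange_tlift; apply: eq_tlift => f1 f2.
rewrite [in RHS]/contract (lin_tsum _ _ (lin_tensl _ (@lin_id k V))).
apply: eq_tlift => h1 v.
by rewrite [RHS](lin_tsum _ _ (lin_tensr _ (@lin_id k W))).
Qed.

Lemma contract_conv V f g (h : H) (v : V) :
  contract g (contract f (\tsum_(h1 ⊗ h2 <- comul h) h1 ⊗ (h2 ⊗ v))) =
  (f * g) h *: v.
Proof.
have lf := fd_lin f; have lg := fd_lin g.
rewrite fd_mulE [in RHS]/tlift scaler_suml.
rewrite (contract_tsum lf) (contract_tsum lg); apply: eq_bigr => -[h1 h2] _ /=.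
by rewrite contract_tens // (linearZP _ (contract_lin lg)) contract_tens // scalerA.
Qed.

(** The functional h |-> f (n * h), written through comul f so that it lies in
    the finite dual by construction. *)
Definition fd_translate f (n : H) : finite_dual H :=
  \tsum_(f1 ⊗ f2 <- comul f) f1 n *: f2.

Lemma fd_translateE f n h : fd_translate f n h = f (n * h).
Proof. by rewrite fd_tsumE -fd_comulE. Qed.

Lemma contract_translate V f n (h : H) (v : V) :
  contract f ((n * h) ⊗ v) = contract (fd_translate f n) (h ⊗ v).
Proof. by rewrite !contract_tens ?fd_translateE //; exact: fd_lin. Qed.
End Dual.

(** * The module structures over the finite dual *)

Section DualAction.
Variables (k : fieldType) (H : hopfType k) (C : coalgType k).
Variable lambda : {linear C -> (H ⊗ C)%type}.
Implicit Types f g : finite_dual H.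

Lemma dual_action_comul :
  (forall c, \tsum_(h ⊗ c' <- lambda c) h ⊗ comul c' =
     \tsum_(c1 ⊗ c2 <- comul c)
       \tsum_(h1 ⊗ e1 <- lambda c1) \tsum_(h2 ⊗ e2 <- lambda c2)
         (h1 * h2) ⊗ (e1 ⊗ e2)) ->
  forall c f, comul (dual_action lambda c f) =
    \tsum_(c1 ⊗ c2 <- comul c) \tsum_(f1 ⊗ f2 <- comul f)
      dual_action lambda c1 f1 ⊗ dual_action lambda c2 f2.
Proof.
move=> hD c f; have lf := fd_lin f.
rewrite -[LHS](contract_map lf _ (linear_lin comul)) hD contract_tsum //.
by apply: eq_tlift => c1 c2; rewrite contract_mul.
Qed.

Lemma dual_action_twice c f g :
  dual_action lambda (dual_action lambda c f) g =
  contract g (contract f (\tsum_(h ⊗ c' <- lambda c) h ⊗ lambda c')).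
Proof. by rewrite (contract_map (fd_lin f) _ (linear_lin lambda)). Qed.

Lemma comodule_coalgebra_dual :
  comodule_coalgebra lambda -> module_coalgebra (dual_action lambda).
Proof.
move=> [h1 h2 h3]; split; first exact: dual_action_bilin.
- exact: h1.
- exact: dual_action_comul.
move=> c f g; have lf := fd_lin f; have lg := fd_lin g.
rewrite dual_action_twice h3 (contract_tsum lf) (contract_tsum lg).
by apply: eq_tlift => h c'; rewrite contract_conv.
Qed.

Lemma counit_dual_action c f : counit (dual_action lambda c f) = f (nabla lambda c).
Proof.
rewrite /dual_action /nabla.
rewrite (lin_tsum _ _ (fd_lin f)) [LHS](lin_tsum _ _ (scalar_lin counit)).
apply: (@eq_tlift k _ _ k^o) => h c'.
by rewrite linearZ (linearZP _ (fd_lin f)); exact: mulrC.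
Qed.

(** The factor nabla(c_1) in the partial coassociativity turns the functional f
    into its translate by nabla(c_1); expanding that translate along comul f
    produces the factor ε(c_1 ↼ f_1). *)
Lemma partial_comodule_coalgebra_dual :
  partial_comodule_coalgebra lambda ->
  partial_module_coalgebra (dual_action lambda).
Proof.
move=> [h1 h2 h3]; split; first exact: dual_action_bilin.
- exact: h1.
- exact: dual_action_comul.
move=> c f g; have lf := fd_lin f; have lg := fd_lin g.
rewrite dual_action_twice h3 (contract_tsum lf) (contract_tsum lg); apply: eq_tlift => c1 c2.
pose fn := fd_translate f (nabla lambda c1).
transitivity (dual_action lambda c2 (fn * g)).
  rewrite (contract_tsum lf) (contract_tsum lg); apply: eq_tlift => h c'.
  rewrite -contract_conv (contract_tsum lf) (contract_tsum (fd_lin fn)).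
  rewrite !(contract_tsum lg).
  by apply: eq_tlift => a b; rewrite contract_translate.
have l : lin (fun f => dual_action lambda c2 (f * g)).
  apply: (lin_comp _ (lin_mull g (@lin_id k (finite_dual H)))).
  exact: (dual_action_bilin lambda).2.
rewrite (lin_tsum _ _ l); apply: eq_tlift => f1 f2.
by rewrite (linearZP _ l) counit_dual_action.
Qed.
End DualAction.

(** * Generation and compatibility *)

Section Generation.
Variables (k : fieldType) (H : hopfType k) (C D : coalgType k).
Variables (lambda : {linear D -> (H ⊗ D)%type}) (theta : {linear C -> D}).

Definition action_span : set D :=
  [set d | exists s : seq (C * finite_dual H),
     d = \sum_(p <- s) dual_action lambda (theta p.1) p.2].

Lemma action_span_subspace : is_subspace action_span.
Proof.
have [lA _] := dual_action_bilin lambda.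
split; first by exists [::]; rewrite big_nil.
move=> a _ _ [s ->] [t ->].
exists ([seq (a *: p.1, p.2) | p <- s] ++ t).
rewrite big_cat big_map /= scaler_sumr; congr (_ + _).
by apply: eq_bigr => p _; rewrite linearZ (linearZP _ (lA _)).
Qed.

Lemma mem_action_span c f : action_span (dual_action lambda (theta c) f).
Proof. by exists [:: (c, f)]; rewrite big_seq1. Qed.

Lemma action_span_ind (P : set D) : is_subspace P ->
  (forall c f, P (dual_action lambda (theta c) f)) -> action_span `<=` P.
Proof. by move=> sP hP _ [s ->]; apply: subspace_sum. Qed.

Lemma subspace_preimage (V W : lmodType k) (F : V -> W) (P : set W) :
  lin F -> is_subspace P -> is_subspace (F @^-1` P).
Proof.
move=> lF [P0 hP]; split; first by rewrite /preimage /= (linear0P lF).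
by move=> a x y Px Py; rewrite /preimage /= lF; exact: hP.
Qed.

Lemma action_span_subcomodule : finite_dual_separates_points H ->
  module_coalgebra (dual_action lambda) ->
  (forall c, comul (theta c) = \tsum_(c1 ⊗ c2 <- comul c) theta c1 ⊗ theta c2) ->
  subcomodule_coalgebra lambda action_span.
Proof.
move=> sep [[lA _] _ actD actM] thetaD; have sS := action_span_subspace.
split=> //.
- apply: action_span_ind.
    exact: subspace_preimage (linear_lin comul) (sub_tensor_subspace _ sS).
  move=> c f; rewrite actD thetaD.
  pose B (d1 d2 : D) := \tsum_(f1 ⊗ f2 <- comul f)
    dual_action lambda d1 f1 ⊗ dual_action lambda d2 f2.
  have hB : bilin B.
    apply: bilinI => d; apply: lin_tlift_body => f1 f2.
      by apply: lin_tensl; exact: lA.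
    by apply: lin_tensr; exact: lA.
  rewrite (lin_tsum _ _ (tlift_linear hB)).
  apply: subspace_sum => [|p]; first exact: sub_tensor_subspace.
  rewrite tliftE //; apply: subspace_sum => [|q]; first exact: sub_tensor_subspace.
  by apply: sub_tensor_tens; exact: mem_action_span.
- move=> d Sd; apply: (@sub_tensor_contract k H D (finite_dual H) (fun f => f)) => //.
    by move=> f; exact: fd_lin.
  move=> f; move: d Sd; apply: action_span_ind.
    exact: subspace_preimage (lA f) sS.
  move=> c g; have := mem_action_span c (g * f); congr action_span; exact/esym/actM.
Qed.
End Generation.

Lemma eq_on_subspace (k : fieldType) (V W : lmodType k) (F G : V -> W) :
  lin F -> lin G -> is_subspace [set v | F v = G v].
Proof.
move=> lF lG; split; first by rewrite /= (linear0P lF) (linear0P lG).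
by move=> a x y /= Fx Fy; rewrite lF lG Fx Fy.
Qed.

Theorem theorem4p22 (k : fieldType) (H : hopfType k) (C D : coalgType k)
    (lambda' : {linear C -> (H ⊗ C)%type})
    (lambda : {linear D -> (H ⊗ D)%type})
    (theta : {linear C -> D}) (pi : {linear D -> D}) :
  partial_comodule_coalgebra lambda' ->
  comodule_globalization lambda' lambda theta pi ->
  finite_dual_separates_points H ->
  partial_module_coalgebra (dual_action lambda') /\
  module_globalization (dual_action lambda') (dual_action lambda) theta pi.
Proof.
move=> hC [hD mono proj compat equiv gen] sep.
have mD := comodule_coalgebra_dual hD.
have [_ thetaD _] := mono.
split; first exact: partial_comodule_coalgebra_dual.
have span_all : action_span lambda theta = setT.
  apply: gen; first exact: action_span_subcomodule.
  move=> _ [c _ <-].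
  have [_ act1 _ _] := mD.
  by rewrite -(act1 (theta c)); exact: mem_action_span.
have [lA _] := dual_action_bilin lambda.
have lpi := linear_lin pi.
split=> //; last first.
- move=> d; have : action_span lambda theta d by rewrite span_all.
  exact.
- move=> c f; have lf := fd_lin f.
  rewrite -[RHS](contract_map lf _ lpi) equiv.
  by rewrite (contract_map lf _ (linear_lin theta)).
move=> f d.
pose R d := pi (\tsum_(d1 ⊗ d2 <- comul d) counit (pi d1) *: dual_action lambda d2 f).
have hB : bilin (fun d1 d2 => counit (pi d1) *: dual_action lambda d2 f).
  apply: bilinI => x; last by apply: lin_scaler; exact: lA.
  apply: lin_scalel => a y z.
  by rewrite linearP [counit _]linearP.
have lR : lin R.
  apply: (lin_comp lpi); apply: lin_tlift => //; exact: linear_lin.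
have lL : lin (fun d => pi (dual_action lambda (pi d) f)).
  exact: (lin_comp lpi (lin_comp (lA f) lpi)).
have : action_span lambda theta d by rewrite span_all.
move: d; apply: action_span_ind; first exact: eq_on_subspace.
move=> c g /=; rewrite -/(R _).
have lf := fd_lin f; have lg := fd_lin g.
pose L d := \tsum_(h ⊗ e <- lambda (pi d)) h ⊗ pi e.
pose L' d := \tsum_(d1 ⊗ d2 <- comul d) \tsum_(h ⊗ e <- lambda d2)
  h ⊗ (counit (pi d1) *: pi e).
have hT : bilin (fun (h : H) e => h ⊗ pi e).
  apply: bilinI => x; [exact: lin_tensl|exact: lin_tensr].
have lL1 : lin L.
  exact: lin_tlift (lin_comp (linear_lin lambda) lpi) hT.
have lL2 : lin L'.
  rewrite /L'; lin.
have rg : range theta (theta c) by exists c.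
(* Contracting the first factor of the compatibility at theta c with g replaces
   theta c by theta c ◂ g; contracting the second with f gives the claim. *)
have := congr1 (fun t => contract f (contract g t)) (compat _ rg).
rewrite (contract_map lg _ lL1) (contract_map lg _ lL2).
rewrite /L (contract_map lf _ lpi) /L' contract_tsum // => ->.
rewrite /R (lin_tsum _ _ lpi); apply: eq_tlift => d1 d2.
by rewrite (contract_map lf _ (lin_scaler _ lpi)) linearZ.
Qed.
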